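(* Let $d\in\mathbb{Z}_q^{M}$ be a filtering vector for the encrypted residuals $\rho^e$, let $X\in\mathbb{Z}_q$ be defined by $d^\top\rho^e \bmod q=(0,X)$, and let $\Sigma_p=\sigma^2T_cT_c^\top$. Let $\alpha\in(0,1)$ and let $\gamma$ be the $\alpha$-quantile in the sense that $$\Pr(|Y|\ge\gamma)=\alpha,\qquad\text{for } Y\sim\mathcal{N}_{\mathbb{Z}_q}(0,\,d^\top\Sigma_p d).$$ Consider the test of the null hypothesis $\mathcal{H}_0$: ''all plaintext residuals are zero, $\rho=0$'', which rejects $\mathcal{H}_0$ when $|X|\ge\gamma$. If $\|T_c^\top d\|_2^2\,\eta_\epsilon^2(\mathbb{L})\le\sigma^2$, then this test has Type I Error probability $\alpha$ up to a statistical distance $\mathcal{O}(\epsilon)$, that is, $\Pr(|X|\ge\gamma\mid\mathcal{H}_0)=\alpha$ up to an error $\mathcal{O}(\epsilon)$.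
   Context: Notation: $\mathbb{Z}_q=\{i\in\mathbb{Z}: -q/2\le i<q/2\}$; $a\bmod q=a-\lfloor (a+q/2)/q\rfloor q\in\mathbb{Z}_q$, applied entrywise to vectors and matrices. $\mathcal{U}_q$ is the uniform distribution on $\mathbb{Z}_q$. For a support set $\mathcal{S}$, the discrete normal $\mathcal{N}_{\mathcal{S}}(\mu,\sigma^2)$ is the distribution on $\mathcal{S}$ with $\Pr(X=x)=e^{-(x-\mu)^2/(2\sigma^2)}/\sum_{y\in\mathcal{S}}e^{-(y-\mu)^2/(2\sigma^2)}$. LWE encryption: with a secret vector $s\in\mathbb{Z}_q^v$ and scaling $r>0$, a message vector $m$ with integer entries is encrypted as $(P,\,Ps+mr+e\bmod q)$, where the entries of $P$ and $s$ are sampled from $\mathcal{U}_q$ and the entries of $e$ are independent $\mathcal{N}_{\mathbb{Z}_q}(0,\sigma^2)$. Integer linear combinations of ciphertexts act on both components, modulo $q$. Encrypted residuals: all scalar residuals over the considered time window are stacked into one vector of length $M$. Let $\rho\in\mathbb{Z}^M$ be the plaintext residual vector. The encrypted residual is $\rho^e=(P^\rho,\;P^\rho s+r\rho+e^\rho)\bmod q$ with $P^\rho\in\mathbb{Z}_q^{M\times v}$, and the residual noise is $e^\rho=T_ce$, where $T_c$ is a fixed known integer matrix (describing the integer linear operations the controller performs to form the residual) and $e$ has independent entries distributed as $\mathcal{N}_{\mathbb{Z}_q}(0,\sigma^2)$. A filtering vector is a nonzero $d\in\mathbb{Z}_q^M$ with $d^\top P^\rho=0\bmod q$, so that $d^\top\rho^e\bmod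 q=(0,X)$ with $X=(r\,d^\top\rho+d^\top e^\rho)\bmod q$; $d$ and $P^\rho$ are treated as given (the randomness is that of $e$). $\eta_\epsilon(\mathbb{L})$ is the smoothing parameter, $0<\epsilon<1$, of the lattice $\mathbb{L}$ underlying the discrete normal distribution of the error entries (integer-valued errors, i.e. $\mathbb{L}=\mathbb{Z}$). Standing assumption on the noise variance: $\sigma^2<\frac{q^2}{4}\frac{\Omega_\epsilon^2}{\|T_c^\top d\|_2^2}$ with $\Omega_\epsilon<1$ chosen so that $\Pr(\|T_c^\top d\|_2|Z|>q/2)\le\mathcal{O}(\epsilon)$ for $Z\sim\mathcal{N}_{\mathbb{Z}_q}(0,\sigma^2)$. It is also assumed that no overflow occurs in the filtered sum: $|r\,d^\top\rho+d^\top e^\rho|\le q/2$.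
   Formalization: The entries of T_c^T d are additionally assumed to have gcd 1 (otherwise X lives on a sublattice gZ and the claim fails, e.g. T_c=(2), d=1); ''no overflow'' is only required up to probability O(ε), and the O(ε) constant is uniform in all other parameters. *)

(* Defs.v *)
From HB Require Import structures.
From mathcomp Require Import all_boot all_order all_algebra finmap.
From mathcomp Require Import zify.
From mathcomp Require Import all_classical all_reals all_analysis.

Set Implicit Arguments.
Unset Strict Implicit.
Unset Printing Implicit Defensive.

Import Order.TTheory GRing.Theory Num.Theory.
Local Open Scope ring_scope.

(* Z_q = {i | -q/2 <= i < q/2}, cut out of the range [-q, q); see in_Zq. *)
Definition Zq (q : nat) : {fset int} :=
  [fset x in [seq i%:Z - q%:Z | i <- iota 0 q.*2]
    | - q%:Z <= x *+ 2 < q%:Z]%fset.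

Lemma in_Zq (q : nat) (x : int) :
  (x \in Zq q) = (- q%:Z <= x *+ 2 < q%:Z).
Proof.
rewrite !inE /= [LHS]andbC; case: (boolP (_ <= _ < _)) => //= /andP[h1 h2].
rewrite mulr2n in h1 h2; apply/mapP; exists `|(x + q%:Z)%R|%N; last by lia.
by rewrite mem_iota; lia.
Qed.

Definition cmod (q : nat) (a : int) : int :=
  a - Num.floor ((a%:~R + q%:R / 2) / q%:R : rat) * q%:Z.

Definition mxcmod (q m n : nat) (A : 'M[int]_(m, n)) : 'M[int]_(m, n) :=
  map_mx (cmod q) A.

Section FiniteProbability.
Context {R : realType}.

Definition Pr (T : finType) (p : T -> R) (A : pred T) : R :=
  \sum_(x | A x) p x.

Definition iid_vec (T : finType) (n : nat) (p : T -> R) (e : 'cV[T]_n) : R :=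
  \prod_i p (e i 0).

Definition dnormal (S : {fset int}) (mu sigma2 : R) (x : S) : R :=
  let g (y : S) := expR (- ((val y)%:~R - mu) ^+ 2 / (2 * sigma2)) in
  g x / \sum_(y : S) g y.

End FiniteProbability.

Section Lattice.
Context {R : realType}.

Definition dual_lattice (L : set R) : set R :=
  [set y | forall x, L x -> exists k : int, x * y = k%:~R]%classic.

(* Micciancio--Regev normalisation: the infimum of the s > 0 such that
   rho_{1/s}(L^* \ {0}) <= eps, where rho_t(y) = exp(- pi y^2 / t^2). *)
Definition smoothing (L : set R) (eps : R) : R :=
  inf [set s : R | 0 < s /\
    (\esum_(y in dual_lattice L `\ 0%R) (expR (- pi * (s * y) ^+ 2))%:E
       <= eps%:E)%E]%classic.

End Lattice.

Definition intlattice (R : realType) : set R := range (fun k : int => k%:~R : R).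
Arguments intlattice R : clear implicits.

Definition l2norm (R : realType) (n : nat) (c : 'cV[int]_n) : R :=
  Num.sqrt (\sum_i (c i 0)%:~R ^+ 2).
Arguments l2norm R {n} c.

Definition enc_residual (q v M : nat) (P : 'M[int]_(M, v)) (s : 'cV[int]_v)
    (r : int) (rho erho : 'cV[int]_M) : 'M[int]_(M, v) * 'cV[int]_M :=
  (mxcmod q P, mxcmod q (P *m s + r *: rho + erho)).

(* Linear combination of the rows of a stacked ciphertext, modulo q. *)
Definition lincomb (q v M : nat) (d : 'cV[int]_M)
    (c : 'M[int]_(M, v) * 'cV[int]_M) : 'rV[int]_v * int :=
  (mxcmod q (d^T *m c.1), cmod q ((d^T *m c.2) 0 0)).

Definition filtering_vector (q v M : nat) (P : 'M[int]_(M, v))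
    (d : 'cV[int]_M) : Prop :=
  [/\ forall i, d i 0 \in Zq q, d != 0 & mxcmod q (d^T *m P) = 0].

Definition res_cov {R : realType} (M N : nat) (sigma : R)
    (Tc : 'M[int]_(M, N)) : 'M[R]_M :=
  let T := map_mx (fun k : int => k%:~R : R) Tc in sigma ^+ 2 *: (T *m T^T).

Definition quadform {R : realType} (M : nat) (S : 'M[R]_M)
    (d : 'cV[int]_M) : R :=
  let dR := map_mx (fun k : int => k%:~R : R) d in (dR^T *m S *m dR) 0 0.

(* For integer vectors e the values c^T e fill the lattice (gcd_vec c) Z, so a
   Gaussian with support Z is a meaningful reference only if gcd_vec c = 1. *)
Definition gcd_vec (n : nat) (c : 'cV[int]_n) : int :=
  \big[gcdz/0]_i c i 0.

(* Main.v *)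
(* Write y = sigma^2 / |c|^2 with c = Tc^T d, so that X is the centered residue
   of c.e.  The smoothing hypothesis gives exp(- pi y) <= eps, and one may
   assume eps < exp(-64), hence y > 16.

   The coordinates of e are added one at a time.  The law of the partial sum is
   compared pointwise, from above only, with the Gaussian of the same variance
   on the lattice generated by the coefficients met so far; adding a coordinate
   costs a factor measuring the oscillation of a one-dimensional Gaussian sum
   over the cosets of a lattice.  When j nonzero coefficients have been met, the
   variance in question is at least j y, so the factor is
   1 + O(exp(-4 j y)), and the product over j is 1 + O(eps) uniformly in the
   dimension.  A pointwise upper bound between two probabilities, used for an
   event and for its complement, bounds the statistical distance.

   The oscillation of theta_w(x) = sum_n exp(-(n+x)^2 / (2w)) is bounded without
   Poisson summation: rotating Z^2 by 45 degrees shows that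
   D_w(x) = theta_w(x) - theta_w(x+1/2) satisfies
     D_{2w}(a) theta_{8w}(2a) = D_w(a) D_w(0),
   so D decays like exp(-4w), and theta_w(x) is recovered from
   theta_{4w}(2x) = theta_w(x) + theta_w(x+1/2).

   Truncating the coordinates to Z_q costs a factor 1 + O(K eps / |c|^2) each:
   the tail beyond q/2 is compared with the mass beyond q/(2|c|), which the
   hypothesis on |c| |Z| > q/2 controls.  If |c| = 1 the test is exact. *)

Require Import Defs.
From mathcomp Require Import all_boot all_order all_algebra finmap.
From mathcomp Require Import zify ring lra.
From mathcomp Require Import all_classical all_reals all_analysis.

Set Implicit Arguments.
Unset Strict Implicit.
Unset Printing Implicit Defensive.

Import Order.TTheory GRing.Theory Num.Theory.
Local Open Scope ring_scope.

(** * Sums over the integers *)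

Section IntegerSums.
Context {R : realType}.
Implicit Types (F G : int -> R) (a : R).

Definition esumZ F : \bar R := \esum_(n in [set: int]) (F n)%:E.

(** [fine] sends [+oo] to 0, so the value is meaningful only together with [psum F]. *)
Definition zsum F : R := fine (esumZ F).

Definition psum F : Prop := (forall n, 0 <= F n) /\ (esumZ F < +oo)%E.

Lemma psum_ge0 F n : psum F -> 0 <= F n.
Proof. by case. Qed.

Lemma esumZ_ge0 F : (forall n, 0 <= F n) -> (0 <= esumZ F)%E.
Proof. by move=> F0; apply: esum_ge0 => n _; rewrite lee_fin. Qed.

Lemma zsumK F : psum F -> (zsum F)%:E = esumZ F.
Proof.
by move=> [F0 Fy]; rewrite fineK// fin_numElt Fy (lt_le_trans _ (esumZ_ge0 F0)).
Qed.

Lemma zsum_ge0 F : psum F -> 0 <= zsum F.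
Proof. by move=> FS; rewrite -lee_fin zsumK//; apply: esumZ_ge0; case: FS. Qed.

Lemma le_esumZ F G : (forall n, F n <= G n) -> (esumZ F <= esumZ G)%E.
Proof. by move=> FG; apply: le_esum => n _; rewrite lee_fin. Qed.

Lemma psum_le F G : (forall n, 0 <= F n) -> (forall n, F n <= G n) ->
  psum G -> psum F.
Proof. by move=> F0 FG [_ Gy]; split=> //; apply: le_lt_trans (le_esumZ FG) Gy. Qed.

Lemma zsum_le F G : psum F -> psum G -> (forall n, F n <= G n) ->
  zsum F <= zsum G.
Proof. by move=> Fs Gs FG; rewrite -lee_fin !zsumK//; apply: le_esumZ. Qed.

Lemma eq_zsum F G : F =1 G -> zsum F = zsum G.
Proof. by move=> /funext ->. Qed.

Lemma eq_psum F G : F =1 G -> psum F -> psum G.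
Proof. by move=> /funext ->. Qed.

Lemma esumZ_le_bound F (c : \bar R) : 
  (forall A : {fset int}, ((\sum_(n <- A) F n)%:E <= c)%E) -> (esumZ F <= c)%E.
Proof.
move=> H; apply: ge_ereal_sup => _ [A [finA _]] <-.
by rewrite fsbig_finite// sumEFin H.
Qed.

Lemma le_fset_esumZ F (A : {fset int}) : (forall n, 0 <= F n) ->
  ((\sum_(n <- A) F n)%:E <= esumZ F)%E.
Proof.
move=> F0; apply: esum_ge; exists [set` A]%classic.
  by split => //; exact: finite_fset.
by rewrite fsbig_finite// set_fsetK sumEFin.
Qed.

Lemma le_fset_zsum F (A : {fset int}) : psum F -> \sum_(n <- A) F n <= zsum F.
Proof. by move=> Fs; rewrite -lee_fin zsumK// le_fset_esumZ//; case: Fs. Qed.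

Lemma le_seq_zsum F (s : seq int) : psum F -> uniq s ->
  \sum_(n <- s) F n <= zsum F.
Proof.
move=> Fs us; apply: le_trans (le_fset_zsum [fset x in s]%fset Fs).
rewrite (perm_big [fset x in s]%fset)//; apply: uniq_perm => // n.
by rewrite inE.
Qed.

Lemma esumZZ_le F a : 0 <= a -> (forall n, 0 <= F n) ->
  (esumZ (fun n => (a * F n)%R) <= a%:E * esumZ F)%E.
Proof.
move=> a0 F0; apply: esumZ_le_bound => A.
by rewrite -mulr_sumr EFinM lee_wpmul2l ?lee_fin// le_fset_esumZ.
Qed.

Lemma psumZ F a : 0 <= a -> psum F -> psum (fun n => a * F n).
Proof.
move=> a0 Fs; have F0 := fun n => psum_ge0 n Fs.
split; first by move=> n; rewrite mulr_ge0.
by apply: le_lt_trans (esumZZ_le a0 F0) _; rewrite -(zsumK Fs) -EFinM ltry.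
Qed.

Lemma zsumZ F a : 0 <= a -> psum F -> zsum (fun n => a * F n) = a * zsum F.
Proof.
move=> a0 Fs; have F0 := fun n => psum_ge0 n Fs.
have aFs := psumZ a0 Fs.
move: (a0); rewrite le_eqVlt => /predU1P[<-|a_gt0].
  rewrite mul0r; apply: EFin_inj; rewrite zsumK; last exact: psumZ.
  by apply: esum1 => n _; rewrite mul0r.
apply/eqP; rewrite eq_le; apply/andP; split.
  by rewrite -lee_fin EFinM !zsumK// esumZZ_le.
rewrite -ler_pdivlMl// -lee_fin EFinM !zsumK//.
(* The reverse inequality is [esumZZ_le] again, for the factor [a^-1] and the function [a * F]. *)
rewrite {1}(_ : F = (fun n => a^-1 * (a * F n))); last first.
  by apply/funext => n; rewrite mulKf// gt_eqF.
by apply: esumZZ_le => [|n]; rewrite ?invr_ge0// mulr_ge0.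
Qed.

Lemma esumZD F G : (forall n, 0 <= F n) -> (forall n, 0 <= G n) ->
  (esumZ (fun n => (F n + G n)%R) = esumZ F + esumZ G)%E.
Proof.
move=> F0 G0; rewrite /esumZ -esumD//.
- by move=> n _; rewrite lee_fin.
- by move=> n _; rewrite lee_fin.
Qed.

Lemma psumD F G : psum F -> psum G -> psum (fun n => F n + G n).
Proof.
move=> Fs Gs; have [F0 Fy] := Fs; have [G0 Gy] := Gs.
split; first by move=> n; rewrite addr_ge0.
by rewrite esumZD// -(zsumK Fs) -(zsumK Gs) -EFinD ltry.
Qed.

Lemma zsumD F G : psum F -> psum G ->
  zsum (fun n => F n + G n) = zsum F + zsum G.
Proof.
move=> Fs Gs; have FGs := psumD Fs Gs; apply: EFin_inj.
rewrite EFinD (zsumK Fs) (zsumK Gs) (zsumK FGs) esumZD//; first by case: Fs.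
by case: Gs.
Qed.

Lemma reindex_esumZ (e : int -> int) F : bijective e ->
  esumZ F = esumZ (F \o e).
Proof.
move=> [e' ee' e'e].
rewrite /esumZ (@reindex_esum _ _ _ [set: int] [set: int] e)//.
split => //= [x y _ _|y _]; first exact: (can_inj ee').
by exists (e' y).
Qed.

Lemma reindex_zsum (e : int -> int) F : bijective e -> zsum F = zsum (F \o e).
Proof. by move=> eb; rewrite /zsum (reindex_esumZ _ eb). Qed.

Lemma reindex_psum (e : int -> int) F : bijective e -> psum F -> psum (F \o e).
Proof.
by move=> eb [F0 Fy]; split=> [n /=//|]; rewrite -reindex_esumZ.
Qed.

Lemma addZ_bij (m : int) : bijective (fun n : int => n + m).
Proof. by exists (fun n => n - m) => n; rewrite ?addrK ?subrK. Qed.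

Lemma subZ_bij (m : int) : bijective (fun n : int => m - n).
Proof. by exists (fun n => m - n) => n; rewrite subKr. Qed.

(** Turns a sum over a sublattice or a coset, cut out by the indicator [P], into a sum over all
    integers. Parity classes and the solutions of a congruence are parametrised in this way. *)
Lemma esumZ_inj (e : int -> int) F (P : pred int) : injective e ->
  (forall n, P n <-> exists m, n = e m) ->
  esumZ (fun n => (P n)%:R * F n) = esumZ (F \o e).
Proof.
move=> ei Pe.
rewrite /esumZ -(@esum_image _ _ _ [set: int] e (fun n => (F n)%:E)); last first.
  by move=> x y _ _; exact: ei.
rewrite [RHS]esum_mkcond; apply: eq_esum => n _.
case: ifPn; rewrite ?inE /=.
  by move=> [m _ <-]; rewrite (Pe _).2 ?mul1r//; exists m.
move=> H; case: (boolP (P n)) => Pn; last by rewrite mul0r.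
by exfalso; move/negP: H; apply; rewrite inE /=; have [m ->] := (Pe n).1 Pn; exists m.
Qed.

Lemma esumZ_parity F : (forall n, 0 <= F n) ->
  (esumZ F = esumZ (fun n => F (n *+ 2)%R) + esumZ (fun n => F (n *+ 2 + 1)%R))%E.
Proof.
move=> F0; pose odd2 (n : int) := odd `|n|%N.
rewrite (_ : F = fun n => ((~~ odd2 n)%:R * F n + (odd2 n)%:R * F n)); last first.
  by apply/funext => n; case: (odd2 n); rewrite /= !(mul1r, mul0r, add0r, addr0).
rewrite esumZD; [|by move=> n; rewrite mulr_ge0 ?ler0n..].
rewrite (@esumZ_inj (fun n => (n *+ 2)%R)); first last.
- move=> n; split; first by move=> h; exists (n %/ 2)%Z; rewrite /odd2 in h; lia.
  by move=> [m ->]; rewrite /odd2; lia.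
- by move=> m n; lia.
rewrite (@esumZ_inj (fun n => (n *+ 2 + 1)%R)); first last.
- move=> n; split; first by move=> h; exists (n %/ 2)%Z; rewrite /odd2 in h; lia.
  by move=> [m ->]; rewrite /odd2; lia.
- by move=> m n; lia.
congr (_ + _)%E; congr esumZ; apply/funext => n /=; rewrite /odd2.
  by rewrite (_ : odd _ = false) /= ?(mul1r, mul0r, addr0)//; lia.
by rewrite (_ : odd _ = true) /= ?(mul1r, mul0r, add0r)//; lia.
Qed.

Lemma psum_comp_inj (e : int -> int) F : injective e -> psum F -> psum (F \o e).
Proof.
move=> ei [F0 Fy]; split=> [n /=//|].
rewrite /esumZ -(@esum_image _ _ _ [set: int] e (fun n => (F n)%:E)); last first.
  by move=> x y _ _; exact: ei.
apply: le_lt_trans Fy; rewrite esum_mkcond; apply: le_esum => n _.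
by case: ifPn => _ //; rewrite lee_fin.
Qed.

Lemma zsum_parity F : psum F ->
  zsum F = zsum (fun n => F (n *+ 2)) + zsum (fun n => F (n *+ 2 + 1)).
Proof.
move=> Fs; have F0 := fun n => psum_ge0 n Fs.
have Fe : psum (fun n => F (n *+ 2)).
  by apply: (@psum_comp_inj (fun n => n *+ 2) F) => // m n; lia.
have Fo : psum (fun n => F (n *+ 2 + 1)).
  by apply: (@psum_comp_inj (fun n => n *+ 2 + 1) F) => // m n; lia.
apply: EFin_inj; rewrite EFinD (zsumK Fs) (zsumK Fe) (zsumK Fo).
exact: esumZ_parity.
Qed.

Lemma exchange_esumZ (F : int -> int -> \bar R) : (forall m n, (0 <= F m n)%E) ->
  \esum_(m in [set: int]) \esum_(n in [set: int]) F m n =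
  \esum_(n in [set: int]) \esum_(m in [set: int]) F m n.
Proof.
move=> F0; rewrite (@esum_esum _ _ _ _ (fun=> setT))// (@esum_esum _ _ _ _ (fun=>
  setT))//.
rewrite (@reindex_esum _ _ _ ([set: int] `*`` (fun=> [set: int]))%classic _ (fun x :
  int * int => (x.2, x.1)))//.
split=> //= [[i1 i2] [j1 j2] /= _ _ [] -> -> //|[i1 i2] _].
by exists (i2, i1).
Qed.

(** Tonelli for real sums: the exchange takes place in the extended reals, where finiteness passes
    from the rows to the columns. *)
Lemma zsum_exchange (F : int -> int -> R) :
  (forall m, psum (F m)) -> psum (fun m => zsum (F m)) ->
  (forall n, psum (fun m => F m n)) /\ psum (fun n => zsum (fun m => F m n)) /\
  zsum (fun m => zsum (F m)) = zsum (fun n => zsum (fun m => F m n)).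
Proof.
move=> Fs Ss.
have F0 m n : 0 <= F m n by exact: psum_ge0.
have E : esumZ (fun m => zsum (F m)) =
    \esum_(n in [set: int]) \esum_(m in [set: int]) (F m n)%:E.
  rewrite -exchange_esumZ; last by move=> m n; rewrite lee_fin.
  by apply: eq_esum => m _; rewrite zsumK.
have P n : psum (fun m => F m n).
  split=> //; case: Ss => S0; apply: le_lt_trans; apply: le_esumZ => m.
  have := le_fset_zsum [fset n]%fset (Fs m).
  by rewrite big_seq_fset1.
have Q : esumZ (fun n => zsum (fun m => F m n)) =
    \esum_(n in [set: int]) \esum_(m in [set: int]) (F m n)%:E.
  by apply: eq_esum => n _; rewrite zsumK.
have S : psum (fun n => zsum (fun m => F m n)).
  split; first by move=> n; apply: zsum_ge0.
  by rewrite Q -E; case: Ss.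
by split=> //; split=> //; apply: EFin_inj; rewrite !zsumK// Q E.
Qed.

Lemma psum_pred1 (m : int) (x : R) : 0 <= x ->
  psum (fun n => (n == m)%:R * x) /\ zsum (fun n => (n == m)%:R * x) = x.
Proof.
move=> x0.
have E : esumZ (fun n => (n == m)%:R * x) = x%:E.
  rewrite -(@esum_set1 R int m (fun=> x%:E))// [RHS]esum_mkcond.
  apply: eq_esum => n _; rewrite (_ : (n \in [set m]%classic) = (n == m)); last first.
    by apply/idP/eqP; rewrite inE.
  by case: eqP => _; rewrite ?mul1r ?mul0r.
have P : psum (fun n => (n == m)%:R * x).
  by split; [move=> n; rewrite mulr_ge0 ?ler0n|rewrite E ltry].
by split=> //; apply: EFin_inj; rewrite zsumK.
Qed.

(* The index n0 is skipped: the other terms of F inject into those of G. *)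
Lemma zsum_le_skip F G (n0 : int) : psum F -> psum G ->
  (forall n, n < n0 -> F n <= G (n + 1)) -> (forall n, n0 < n -> F n <= G n) ->
  zsum F <= F n0 + zsum G.
Proof.
move=> Fs Gs lo hi.
have F0 := fun n => psum_ge0 n Fs; have G0 := fun n => psum_ge0 n Gs.
pose G1 n := (n <= n0)%R%:R * G n; pose G2 n := (n0 < n)%R%:R * G n.
have le1 (b : bool) x : 0 <= x -> b%:R * x <= x :> R.
  by case: b; rewrite ?mul1r ?mul0r.
have G1s : psum G1.
  by apply: psum_le Gs => n; rewrite /G1 ?mulr_ge0 ?ler0n// le1.
have G2s : psum G2.
  by apply: psum_le Gs => n; rewrite /G2 ?mulr_ge0 ?ler0n// le1.
have [F1s F1E] := psum_pred1 n0 (F0 n0).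
have G1s' := reindex_psum (addZ_bij 1) G1s.
have -> : zsum G = zsum G1 + zsum G2.
  rewrite -zsumD//; apply: eq_zsum => n; rewrite /G1 /G2.
  by case: (ltP n0 n); rewrite ?(mul1r,mul0r,add0r,addr0).
rewrite (reindex_zsum G1 (addZ_bij 1)) addrA -{1}F1E -zsumD// -zsumD//;
  last exact: psumD.
apply: zsum_le => //; first by apply: psumD => //; exact: psumD.
move=> n; rewrite /G1 /G2 /=; case: (ltgtP n n0) => h.
- have -> : n + 1 <= n0 by rewrite lezD1.
  by rewrite /= mul0r mul0r add0r addr0 mul1r lo.
- have -> : (n + 1 <= n0) = false by apply/negbTE; rewrite lezD1 -leNgt ltW.
  by rewrite /= !mul0r !add0r mul1r hi.
- have -> : (n + 1 <= n0) = false by apply/negbTE; rewrite lezD1 h ltxx.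
  by rewrite /= !mul0r !addr0 mul1r h.
Qed.

(** [A] lies among the integers [i] and [- i] with [i < N], and each of these two families has a
    geometric sum of at most 2. *)
Lemma sum_geo_fset (A : {fset int}) :
  \sum_(n <- A) (2^-1 : R) ^+ `|n|%N <= 4.
Proof.
have [N HN] : exists N : nat, forall n, n \in A -> (`|n| < N)%N.
  exists (\max_(n <- A) `|n|%N).+1 => n nA.
  by rewrite ltnS (big_rem n)//= leq_maxl.
have geo k : \sum_(i < k) (2^-1 : R) ^+ i <= 2.
  rewrite (_ : \sum_(i < k) _ = 2 - 2 * 2^-1 ^+ k); last first.
    elim: k => [|k IH]; first by rewrite big_ord0 expr0; lra.
    by rewrite big_ord_recr /= IH exprS; field.
  by rewrite gerBl mulr_ge0// exprn_ge0// invr_ge0.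
pose s := [seq i%:Z | i <- iota 0 N] ++ [seq - (i%:Z) | i <- iota 0 N].
apply: (@le_trans _ _ (\sum_(n <- s) (2^-1 : R) ^+ `|n|%N)); last first.
  rewrite big_cat !big_map /=.
  rewrite (eq_bigr (fun i => (2^-1 : R) ^+ i)); last by move=> i _.
  rewrite [X in _ + X](eq_bigr (fun i => (2^-1 : R) ^+ i)); last first.
    by move=> i _; rewrite abszN.
  have -> : \sum_(i <- iota 0 N) (2^-1 : R) ^+ i = \sum_(i < N) 2^-1 ^+ i.
    by rewrite -(big_mkord xpredT (fun i => (2^-1 : R) ^+ i)) /index_iota subn0.
  by apply: le_trans (lerD (geo N) (geo N)) _; lra.
have sub : {subset A <= undup s}.
  move=> n /HN h; rewrite mem_undup mem_cat; apply/orP.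
  case: (leP 0 n) => n0; [left|right]; apply/mapP; exists `|n|%N;
    rewrite ?mem_iota; lia.
have us : uniq (undup s) by exact: undup_uniq.
have -> : \sum_(n <- A) (2^-1 : R) ^+ `|n|%N =
    \sum_(n <- undup s | n \in A) (2^-1 : R) ^+ `|n|%N.
  rewrite -[RHS]big_filter; apply: perm_big; apply: uniq_perm => //.
  - exact: filter_uniq.
  - by move=> n; rewrite mem_filter; case: (boolP (n \in A)) => //= /sub ->.
apply: (@le_trans _ _ (\sum_(n <- undup s) (2^-1 : R) ^+ `|n|%N)).
  rewrite big_mkcond; apply: ler_sum => n _; case: ifP => _.
    by rewrite lexx.
  by apply: exprn_ge0; rewrite invr_ge0.
(* The list [s] may contain 0 twice; removing duplicates can only lower a sum of nonnegative
   terms. *)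
elim: s {sub us} => [|n s IH]; first by rewrite /= big_nil.
rewrite /=; case: ifP => _; rewrite !big_cons; last by rewrite lerD2l.
by apply: le_trans IH _; rewrite lerDr exprn_ge0// invr_ge0.
Qed.

Lemma psum_geo : psum (fun n => (2^-1 : R) ^+ `|n|%N).
Proof.
split; first by move=> n; rewrite exprn_ge0// invr_ge0.
apply: (@le_lt_trans _ _ 4%:E); last exact: ltry.
by apply: esumZ_le_bound => A; rewrite lee_fin sum_geo_fset.
Qed.

Lemma zsum_geo : zsum (fun n => (2^-1 : R) ^+ `|n|%N) <= 4.
Proof.
rewrite -lee_fin zsumK; last exact: psum_geo.
by apply: esumZ_le_bound => A; rewrite lee_fin sum_geo_fset.
Qed.

End IntegerSums.

(** * Oscillation of theta functions *)

Section Theta.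
Context {R : realType}.
Implicit Types w x y a b : R.

Definition gauss w x : R := expR (- x ^+ 2 / (2 * w)).

Lemma gauss_gt0 w x : 0 < gauss w x. Proof. exact: expR_gt0. Qed.

Lemma gauss_ge0 w x : 0 <= gauss w x. Proof. exact: expR_ge0. Qed.

Lemma gauss_le1 w x : 0 < w -> gauss w x <= 1.
Proof.
move=> w0; rewrite expR_le1 mulNr oppr_le0.
by rewrite divr_ge0// ?sqr_ge0// mulr_ge0// ltW.
Qed.

Lemma gauss0 w : gauss w 0 = 1.
Proof. by rewrite /gauss expr0n /= oppr0 mul0r expR0. Qed.

Lemma gaussN w x : gauss w (- x) = gauss w x.
Proof. by rewrite /gauss sqrrN. Qed.

Lemma le_gauss w x y : 0 < w -> y ^+ 2 <= x ^+ 2 -> gauss w x <= gauss w y.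
Proof.
move=> w0 yx; rewrite ler_expR ler_pM2r ?lerN2//.
by rewrite invr_gt0 mulr_gt0.
Qed.

Lemma gaussM w v x y x' y' : x ^+ 2 / w + y ^+ 2 / w = x' ^+ 2 / v + y' ^+ 2 / v ->
  gauss w x * gauss w y = gauss v x' * gauss v y'.
Proof.
move=> h; rewrite /gauss -!expRD !invfM !mulNr -!opprD; congr (expR (- _)).
by rewrite !(mulrCA _ 2^-1) -!mulrDr h.
Qed.

Lemma expRN1_le : expR (- 1) <= 2^-1 :> R.
Proof.
rewrite expRN lef_pV2 ?posrE ?expR_gt0//.
by have := expR_ge1Dx (1 : R); lra.
Qed.

(** Two squares give this: [(n + x)^2 >= n^2 / 2 - x^2] and [n^2 / 2 + 2 w^2 >= 2 w |n|].
    Summability of every shifted Gaussian follows. *)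
Lemma gauss_le_geo w x (n : int) : 0 < w ->
  gauss w (n%:~R + x) <= expR (x ^+ 2 / (2 * w) + w) * 2^-1 ^+ `|n|%N.
Proof.
move=> w0.
apply: (@le_trans _ _ (expR (x ^+ 2 / (2 * w) + w) * expR (- 1) ^+ `|n|%N)); last first.
  by rewrite ler_pM2l ?expR_gt0// lerXn2r ?nnegrE ?expR_ge0 ?invr_ge0// expRN1_le.
rewrite -expRM_natl -expRD ler_expR mulrN1.
have -> : (`|n|%N)%:R = `|n%:~R| :> R by rewrite natr_absz intr_norm.
set z : R := n%:~R; set m := `|z|.
have zm : z ^+ 2 = m ^+ 2 by rewrite /m real_normK// num_real.
have w2 : 2 * w != 0 by rewrite mulf_neq0 ?gt_eqF.
have h : m ^+ 2 / 2 - x ^+ 2 <= (z + x) ^+ 2.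
  rewrite -zm; have := sqr_ge0 (z / 2 + x); have := sqr_ge0 z; nra.
have -> : x ^+ 2 / (2 * w) + w - m = (x ^+ 2 + 2 * w * w - 2 * w * m) / (2 * w).
  by field; rewrite gt_eqF.
rewrite ler_pM2r ?invr_gt0 ?mulr_gt0//.
have := sqr_ge0 (m / 2 - w); nra.
Qed.

Lemma psum_gauss w x : 0 < w -> psum (fun n => gauss w (n%:~R + x)).
Proof.
move=> w0; apply: psum_le (psumZ (expR_ge0 (x ^+ 2 / (2 * w) + w)) psum_geo) => n.
  exact: gauss_ge0.
exact: gauss_le_geo.
Qed.

Definition theta w x : R := zsum (fun n => gauss w (n%:~R + x)).

Lemma theta_ge0 w x : 0 < w -> 0 <= theta w x.
Proof. by move=> w0; apply/zsum_ge0/psum_gauss. Qed.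

Lemma theta_periodic w x (m : int) : theta w (x + m%:~R) = theta w x.
Proof.
rewrite [RHS]/theta (reindex_zsum _ (addZ_bij m)).
by apply: eq_zsum => n /=; rewrite intrD -addrA [m%:~R + x]addrC.
Qed.

Lemma theta_periodic1 w x : theta w (x + 1) = theta w x.
Proof. exact: (theta_periodic w x 1). Qed.

(** The even and the odd indices give the two terms, because halving the points divides the variance
    by 4. *)
Lemma theta_doubling w x : 0 < w ->
  theta (4 * w) (2 * x) = theta w x + theta w (x + 2^-1).
Proof.
move=> w0; rewrite /theta zsum_parity; last by apply: psum_gauss; rewrite mulr_gt0.
have w1 : w != 0 by rewrite gt_eqF.
congr (_ + _); apply: eq_zsum => n; rewrite /gauss; congr expR.
  by rewrite mulr2n ?intrD; field.
by rewrite mulr2n ?intrD; field.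
Qed.

Lemma thetaM w v x y : 0 < w -> 0 < v ->
  psum (fun m : int => zsum (fun n : int => gauss w (m%:~R + x) * gauss v (n%:~R + y)))
    /\
  zsum (fun m : int => zsum (fun n : int => gauss w (m%:~R + x) * gauss v (n%:~R + y)))
    = theta w x * theta v y.
Proof.
move=> w0 v0.
have E : (fun m : int => zsum (fun n : int => gauss w (m%:~R + x) * gauss v (n%:~R +
  y)))
   =1 (fun m : int => theta v y * gauss w (m%:~R + x)).
  by move=> m; rewrite zsumZ ?gauss_ge0 1?mulrC//; exact: psum_gauss.
rewrite (eq_zsum E); split.
  apply: (eq_psum (fsym E)); apply: psumZ; first exact: theta_ge0.
  exact: psum_gauss.
by rewrite zsumZ 1?mulrC ?theta_ge0//; exact: psum_gauss.
Qed.

(* Rotating the lattice Z^2 by 45 degrees: the pairs (m + n, m - n) are the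
   pairs of integers of equal parity. *)
Lemma theta_prod w a b : 0 < w ->
  theta (2 * w) a * theta (2 * w) b =
  theta w ((a + b) / 2) * theta w ((a - b) / 2) +
  theta w ((a + b + 1) / 2) * theta w ((a - b + 1) / 2).
Proof.
move=> w0; have w1 : w != 0 by rewrite gt_eqF.
have w2 : 0 < 2 * w by rewrite mulr_gt0.
pose g := gauss (2 * w).
have [S E] := thetaM a b w2 w2.
(* [u] stands for [m + n]; once it is the outer index, its parity produces the two products. *)
pose F (m u : int) := g (m%:~R + a) * g ((u - m)%:~R + b).
have rowE (m : int) : zsum (fun n : int => g (m%:~R + a) * g (n%:~R + b)) = zsum (F m).
  by rewrite (reindex_zsum _ (addZ_bij (- m))).
have Fs m : psum (F m).
  apply: (reindex_psum (addZ_bij (- m)) (F := fun n => g (m%:~R + a) * g (n%:~R + b))).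
  by apply: psumZ; [exact: gauss_ge0|exact: psum_gauss].
rewrite -E (eq_zsum rowE).
have S' : psum (fun m => zsum (F m)) by apply: eq_psum S.
have [cs [S'' ->]] := zsum_exchange Fs S'.
rewrite zsum_parity//; congr (_ + _).
  rewrite -(thetaM _ _ w0 w0).2; apply: eq_zsum => u.
  rewrite (reindex_zsum _ (addZ_bij u)); apply: eq_zsum => m.
  apply: gaussM; rewrite mulr2n !(intrD, intrN); field.
  exact: w1.
rewrite -(thetaM _ _ w0 w0).2; apply: eq_zsum => u.
rewrite (reindex_zsum _ (addZ_bij (u + 1))); apply: eq_zsum => m.
apply: gaussM; rewrite mulr2n !(intrD, intrN); field.
exact: w1.
Qed.

Lemma theta_le_near w x y : 0 < w -> y <= x <= y + 1 ->
  theta w x <= 1 + theta w y.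
Proof.
move=> w0 /andP[yx xy].
(* After [n0] the point [n + x] is farther from 0 than [n + y], and before [n0] it is farther than
   [n + 1 + y]. Only the term at [n0] stays unmatched, and it is at most 1. *)
pose n0 : int := Num.floor (- (x + y) / 2).
have n0l : n0%:~R <= - (x + y) / 2 by exact: Num.Theory.floor_le.
have n0u : - (x + y) / 2 < n0%:~R + 1 by rewrite -intrD1 Num.Theory.floorD1_gt.
apply: le_trans (_ : gauss w (n0%:~R + x) + theta w y <= _); last first.
  by rewrite lerD2r gauss_le1.
apply: zsum_le_skip; [exact: psum_gauss|exact: psum_gauss| |].
  move=> n; rewrite -lezD1 -(ler_int R) intrD => h; apply: le_gauss => //.
  nra.
move=> n; rewrite -lezD1 -(ler_int R) intrD => h; apply: le_gauss => //; nra.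
Qed.

Lemma theta_osc1 w x y : 0 < w -> theta w x <= 1 + theta w y.
Proof.
move=> w0; rewrite -(theta_periodic w y (Num.floor (x - y))).
apply: theta_le_near => //.
have := Num.Theory.floor_le (x - y); have := Num.Theory.floorD1_gt (x - y).
rewrite intrD; lra.
Qed.

(** By periodicity [x] becomes some [u] in [[0, 1]], and the four points of [u + Z] nearest to 0
    already suffice. The constant 3/2 leaves room below the asymptotic [sqrt (2 pi)]. *)
Lemma theta_ge_base w x : 1 <= w <= 4 -> 3 / 2 * Num.sqrt w <= theta w x.
Proof.
move=> /andP[w1 w4].
have w0 : 0 < w by lra.
have wn : w != 0 by rewrite gt_eqF.
rewrite -(theta_periodic w x (- Num.floor x)).
have : 0 <= x + (- Num.floor x)%:~R <= 1.
  have := Num.Theory.floor_le x; have := Num.Theory.floorD1_gt x.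
  rewrite intrD intrN; lra.
move: (x + _) => u /andP[u0 u1].
apply: le_trans (@le_seq_zsum _ _ [:: 0; -1; 1; -2] (psum_gauss u w0) _) => //.
rewrite !big_cons big_nil addr0.
(* [m] is the mean of the four exponents at [u = 0] and at [u = 1]. The tangents of [expR] at [- m]
   therefore add up to at least [4 expR (- m)] on the whole interval. *)
pose m := 3 / (4 * w).
have tg z : expR (- m) * (1 + m - z ^+ 2 / (2 * w)) <= gauss w z.
  rewrite (_ : gauss w z = expR (- m) * expR (m - z ^+ 2 / (2 * w))); last first.
    by rewrite -expRD; congr expR; rewrite addKr mulNr.
  by rewrite ler_pM2l ?expR_gt0// -addrA expR_ge1Dx.
have sqm : (1 - m / 2) ^+ 2 <= expR (- m).
  rewrite (_ : - m = 2%:R * (- m / 2)); last by field.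
  rewrite expRM_natl lerXn2r ?nnegrE ?expR_ge0//.
    rewrite subr_ge0 /m; rewrite ler_pdivrMr// mulrC ler_pdivrMl//; lra.
  by have := expR_ge1Dx (- m / 2); rewrite mulNr.
have [s [-> s0 sw]] : exists s, [/\ Num.sqrt w = s, 0 < s & w = s ^+ 2].
  by exists (Num.sqrt w); rewrite sqrtr_gt0 sqr_sqrtr// ltW.
have s1 : 1 <= s by rewrite sw in w1; clear -w1 s0; nra.
have s2 : s <= 2 by rewrite sw in w4; clear -w4 s0; nra.
have step : 3 / 2 * s <= 4 * (1 - m / 2) ^+ 2.
  have -> : m = 3 / 4 * s^-1 ^+ 2 by rewrite /m sw; field; rewrite gt_eqF.
  pose t := s^-1; rewrite -/t.
  have t0 : 0 < t by rewrite invr_gt0.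
  have ts : s = t^-1 by rewrite invrK.
  have t1 : t <= 1 by rewrite invf_le1.
  have t2 : 2^-1 <= t by rewrite lef_pV2 ?posrE.
  rewrite ts ler_pdivrMr//.
  have t3 : 0 <= (t - 2^-1) * (1 - t) by rewrite mulr_ge0 ?subr_ge0.
  (* [19 / 16 - 9 / 16 t] is the chord of the concave function [1 - 3 / 8 t^2] over [[1/2, 1]]. *)
  apply: (@le_trans _ _ (4 * (19 / 16 - 9 / 16 * t) ^+ 2 * t)).
    have : 0 <= (t - 2^-1) * (1 - t) * (441 / 2 - 81 * t).
      by apply: mulr_ge0 t3 _; clear -t1; lra.
    clear -t1; lra.
  have c1 : 0 <= 19 / 16 - 9 / 16 * t by clear -t1; lra.
  have c2 : 19 / 16 - 9 / 16 * t <= 1 - 3 / 4 * t ^+ 2 / 2 by clear -t3; lra.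
  by rewrite ler_pM2r// ler_pM2l// lerXn2r ?nnegrE// (le_trans c1).
apply: le_trans step _.
apply: (@le_trans _ _ (4 * expR (- m))); first by rewrite ler_pM2l.
have e0 := expR_gt0 (- m).
apply: (@le_trans _ _ (expR (- m) * ((1 + m - (0%:~R + u) ^+ 2 / (2 * w)) + ((1 + m -
  ((-1)%:~R + u) ^+ 2 / (2 * w)) + ((1 + m - (1%:~R + u) ^+ 2 / (2 * w)) + (1 + m -
  ((-2)%:~R + u) ^+ 2 / (2 * w))))))).
  rewrite mulrC ler_pM2l//.
  rewrite (_ : _ + (_ + _) = 4 + (4 * u * (1 - u)) / (2 * w)); last first.
    by rewrite /m !(intrN) ; field; rewrite gt_eqF.
  by rewrite lerDl divr_ge0 ?mulr_ge0 ?subr_ge0// ltW.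
by rewrite !mulrDr !lerD// -?mulrDr tg.
Qed.

(** [theta_doubling] divides [w] by 4 and preserves the constant, as two terms of size
    [sqrt (w / 4)] add up to [sqrt w]. This reduces to the interval [[1, 4]]. *)
Lemma theta_ge w x : 1 <= w -> 3 / 2 * Num.sqrt w <= theta w x.
Proof.
have H n : forall w x, 1 <= w -> w <= 4 ^+ n.+1 -> 3 / 2 * Num.sqrt w <= theta w x.
  elim: n => [|n IH] {}w {}x w1 wn.
    by apply: theta_ge_base; rewrite w1; move: wn; rewrite expr1.
  have [w4|w4] := leP w 4; first by apply: theta_ge_base; rewrite w1.
  have -> : w = 4 * (w / 4) by field.
  have -> : x = 2 * (x / 2) by field.
  rewrite theta_doubling; last by lra.
  rewrite sqrtrM// (_ : 4 = 2 ^+ 2 :> R); last by ring.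
  rewrite sqrtr_sqr ger0_norm//.
  have wn' : w / 2 ^+ 2 <= 4 ^+ n.+1 by rewrite exprS in wn; lra.
  have w1' : 1 <= w / 2 ^+ 2 by lra.
  have := IH _ (x / 2) w1' wn'; have := IH _ (x / 2 + 2^-1) w1' wn'; lra.
move=> w1.
apply: (H (Num.truncn w)) => //.
have := truncnS_gt w.
move: (Num.truncn w) => n h; apply: le_trans (ltW h) _.
elim: n.+1 => [|k IH]; first by rewrite expr0 ler01.
rewrite exprS -natr1; have : 1 <= (4 : R) ^+ k by apply: exprn_ege1; lra.
lra.
Qed.

(** In Fourier terms only the odd frequencies of [theta w] survive, which is why the difference
    decays so fast in [w]. *)
Definition theta_jump w x := theta w x - theta w (x + 2^-1).

(** By [theta_doubling] the second factor on the left is the sum of the two values whose difference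
    is the first one. The product is thus a difference of two squares, and [theta_prod] with equal
    arguments expands each of them. *)
Lemma theta_jumpM w a : 0 < w ->
  theta_jump (2 * w) a * theta (8 * w) (2 * a) = theta_jump w a * theta_jump w 0.
Proof.
move=> w0; rewrite /theta_jump.
have -> : 8 * w = 4 * (2 * w) by ring.
rewrite theta_doubling ?mulr_gt0// add0r.
have H1 := theta_prod a a w0.
have H2 := theta_prod (a + 2^-1) (a + 2^-1) w0.
rewrite !subrr !mul0r !add0r in H1 H2.
have e1 : (a + a) / 2 = a by field.
have e2 : (a + a + 1) / 2 = a + 2^-1 by field.
have e3 : (a + 2^-1 + (a + 2^-1)) / 2 = a + 2^-1 by field.
have e4 : (a + 2^-1 + (a + 2^-1) + 1) / 2 = a + 1 by field.
rewrite e1 e2 mul1r in H1; rewrite e3 e4 theta_periodic1 mul1r in H2.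
set t := theta (2 * w) a in H1 *; set t' := theta (2 * w) (a + 2^-1) in H2 *.
rewrite (_ : _ * _ = t * t - t' * t'); last by ring.
by rewrite H1 H2; ring.
Qed.

(** Induction by doubling: the squared bound at [w / 2] is [18 w expR (- 4 w)], and division by
    [3 sqrt w], from [theta_ge], returns the same bound at [w]. On the base interval [[1/8, 1/4]]
    the jump is at most 1. *)
Lemma theta_jump_le w x : 8^-1 <= w ->
  `|theta_jump w x| <= 6 * Num.sqrt w * expR (- (4 * w)).
Proof.
have e13 : 3^-1 <= expR (- 1) :> R.
  apply: (@le_trans _ _ ((1 - 8^-1) ^+ 8)); first by lra.
  rewrite (_ : - 1 = 8%:R * (- 8^-1) :> R); last by field.
  rewrite expRM_natl lerXn2r ?nnegrE ?expR_ge0//; first by lra.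
  by have := expR_ge1Dx (- 8^-1 : R).
have base v y : 8^-1 <= v -> v <= 4^-1 ->
    `|theta_jump v y| <= 6 * Num.sqrt v * expR (- (4 * v)).
  move=> v8 v4; have v0 : 0 < v by lra.
  apply: (@le_trans _ _ 1).
    rewrite ler_norml /theta_jump.
    have := theta_osc1 y (y + 2^-1) v0; have := theta_osc1 (y + 2^-1) y v0; lra.
  set s : R := Num.sqrt v; have s0 : 0 < s by rewrite sqrtr_gt0.
  have sv : v = s ^+ 2 by rewrite sqr_sqrtr// ltW.
  have sl : 10^-1 *+ 3 < s by rewrite sv in v8; nra.
  have su : s <= 2^-1 by rewrite sv in v4; nra.
  (* [expR (- 4 v)] is bounded below by [(2 - 4 v) / 3]; the remaining inequality becomes an
     equality at [v = 1/4]. *)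
  apply: (@le_trans _ _ (6 * s * (3^-1 * (2 - 4 * v)))).
    rewrite sv; nra.
  rewrite ler_pM2l ?mulr_gt0//.
  rewrite (_ : - (4 * v) = - 1 + (1 - 4 * v)); last by ring.
  rewrite expRD ler_pM//; [lra|].
  by have := expR_ge1Dx (1 - 4 * v); lra.
have H n : forall w x, 8^-1 <= w -> w <= 2 ^+ n / 4 ->
    `|theta_jump w x| <= 6 * Num.sqrt w * expR (- (4 * w)).
  elim: n => [|n IH] {}w {}x w8 wn.
    by apply: base => //; move: wn; rewrite expr0 mul1r.
  have [w4|w4] := leP w 4^-1; first exact: base.
  rewrite exprS in wn.
  pose v := w / 2; have v8 : 8^-1 <= v by rewrite /v; lra.
  have vn : v <= 2 ^+ n / 4 by rewrite /v; lra.
  have v0 : 0 < v by lra.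
  have wv : w = 2 * v by rewrite /v; field.
  have := theta_jumpM x v0.
  have I1 := IH v x v8 vn; have I2 := IH v 0 v8 vn.
  have w0 : 0 < w by lra.
  have Hth := @theta_ge (8 * v) (2 * x) ltac:(lra).
  rewrite -wv => E.
  set s : R := Num.sqrt w; have s0 : 0 < s by rewrite sqrtr_gt0.
  have sw : s ^+ 2 = w by rewrite sqr_sqrtr// ltW.
  have E8 : Num.sqrt (8 * v) = 2 * s.
    rewrite (_ : 8 * v = 2 ^+ 2 * w); last by rewrite wv; ring.
    by rewrite sqrtrM// sqrtr_sqr ger0_norm.
  rewrite E8 in Hth.
  have th0 : 0 < theta (8 * v) (2 * x) by lra.
  rewrite -(ler_pM2r th0) -[X in _ * X <= _](gtr0_norm th0) -normrM E normrM.
  apply: (@le_trans _ _ ((6 * Num.sqrt v * expR (- (4 * v))) * (6 * Num.sqrt v * expR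
    (- (4 * v))))).
    by rewrite ler_pM.
  rewrite (_ : _ * _ = 36 * (Num.sqrt v ^+ 2) * (expR (- (4 * v)) * expR (- (4 * v))));
    last by ring.
  rewrite -expRD sqr_sqrtr ?(ltW v0)// (_ : _ + - _ = - (4 * w)); last by rewrite wv;
    ring.
  have e0 := expR_gt0 (- (4 * w)).
  rewrite [leRHS]mulrAC ler_pM2r//.
  have vs : v = s ^+ 2 / 2 by rewrite sw.
  move: (theta _ _) Hth => th Hth; rewrite vs; clear -Hth s0.
  have h : 0 <= s * (th - 3 / 2 * (2 * s)) by rewrite mulr_ge0 ?subr_ge0 ?(ltW s0).
  lra.
move=> w8; apply: (H (Num.truncn (4 * w)).+1) => //.
have := truncnS_gt (4 * w).
move: (Num.truncn _) => n h; rewrite ler_pdivlMr// mulrC.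
apply: le_trans (ltW h) _.
elim: n.+1 {h} => [|k IH]; first by rewrite expr0 ler01.
rewrite exprS -natr1; have : 1 <= (2 : R) ^+ k by apply: exprn_ege1; lra.
lra.
Qed.

(** [theta w x] is half of [theta (4 w) (2 x) + theta_jump w x], so passing to [4 w] halves the
    oscillation up to jumps. After [n] steps the crude bound 1 contributes only [2^-n], while the
    constant 12 reproduces itself. *)
Lemma theta_osc w x y : 8^-1 <= w ->
  theta w x - theta w y <= 12 * Num.sqrt w * expR (- (4 * w)).
Proof.
move=> w8; have w0 : 0 < w by lra.
suff H n : forall w x y, 8^-1 <= w ->
    theta w x - theta w y <= 12 * Num.sqrt w * expR (- (4 * w)) + 2^-1 ^+ n.
  apply/ler_addgt0Pr => e e0.
  pose n := Num.truncn e^-1.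
  apply: le_trans (H n w x y w8) _; rewrite lerD2l exprVn.
  rewrite invf_ple ?posrE ?exprn_gt0//.
  apply: le_trans (ltW (truncnS_gt e^-1)) _.
  rewrite -/n; elim: n => [|k IH]; first by rewrite expr0.
  rewrite exprS -natr1; have : 1 <= (2 : R) ^+ k by apply: exprn_ege1; lra.
  lra.
elim: n => [|n IH] {w0 w8}w {}x {}y w8; have w0 : 0 < w by lra.
  rewrite expr0; have := theta_osc1 x y w0.
  have : 0 <= 12 * Num.sqrt w * expR (- (4 * w)).
    by rewrite !mulr_ge0 ?sqrtr_ge0 ?expR_ge0.
  lra.
have := IH (4 * w) (2 * x) (2 * y) ltac:(lra).
rewrite !theta_doubling// exprS.
have := theta_jump_le x w8; have := theta_jump_le y w8.
rewrite /theta_jump !ler_norml => /andP[Jy _] /andP[_ Jx].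
rewrite (_ : Num.sqrt (4 * w) = 2 * Num.sqrt w); last first.
  by rewrite (_ : 4 = 2 ^+ 2 :> R); [rewrite sqrtrM// sqrtr_sqr ger0_norm|ring].
have ex : expR (- (4 * (4 * w))) <= expR (- (4 * w)) / 2.
  rewrite (_ : - (4 * (4 * w)) = - (4 * w) + - (12 * w)); last by ring.
  rewrite expRD ler_pM2l ?expR_gt0//; apply: le_trans expRN1_le.
  by rewrite ler_expR; lra.
have s0 := sqrtr_ge0 w; move: ex Jx Jy.
have : 0 <= 2^-1 ^+ n :> R by rewrite exprn_ge0// invr_ge0.
move: (expR _) (expR _) (Num.sqrt w) s0 (2^-1 ^+ n) => e1 e2 s s0 p p0 h.
nra.
Qed.

(** 8 is the quotient of the constant 12 in [theta_osc] by the constant 3/2 in [theta_ge]. *)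
Lemma theta_ratio w x y : 1 <= w ->
  theta w x <= (1 + 8 * expR (- (4 * w))) * theta w y.
Proof.
move=> w1; have := @theta_osc w x y ltac:(lra).
have := theta_ge y w1; have := expR_gt0 (- (4 * w)).
by move: (expR _) (Num.sqrt w) (theta w x) => e s t; nra.
Qed.

End Theta.

(** * Convolution of lattice Gaussians *)

Section LatticeGauss.
Context {R : realType}.
Implicit Types (w v : R) (g c k : int).

Definition latgauss v g k : R := (g %| k)%Z%:R * gauss v k%:~R.

Lemma latgauss_ge0 v g k : 0 <= latgauss v g k.
Proof. by rewrite mulr_ge0 ?ler0n ?gauss_ge0. Qed.

Lemma latgauss_le v g k : latgauss v g k <= gauss v k%:~R.
Proof.
by rewrite /latgauss; case: (g %| k)%Z; rewrite ?mul1r ?mul0r ?gauss_ge0.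
Qed.

Lemma psum_gauss0 w : 0 < w -> psum (fun k => gauss w k%:~R).
Proof.
move=> w0; by apply: eq_psum (psum_gauss 0 w0) => k; rewrite addr0.
Qed.

Lemma zsum_gauss0 w : zsum (fun k => gauss w k%:~R) = theta w 0.
Proof. by apply: eq_zsum => k; rewrite addr0. Qed.

Lemma psum_latgauss v g : 0 < v -> psum (latgauss v g).
Proof.
move=> v0; apply: psum_le (psum_gauss0 v0) => k; first exact: latgauss_ge0.
exact: latgauss_le.
Qed.

Lemma zsum_latgauss_ge1 v g : 0 < v -> 1 <= zsum (latgauss v g).
Proof.
move=> v0; apply: le_trans (@le_seq_zsum _ _ [:: 0] (psum_latgauss g v0) _) => //.
by rewrite big_seq1 /latgauss dvdz0 mul1r gauss0.
Qed.

(* Since x / 0 = 0, [gauss 0] is constantly 1, so the convention covers the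
   empty sum. *)
Lemma latgauss00 k : latgauss 0 0 k = (k == 0)%:R.
Proof.
rewrite /latgauss dvd0z; case: eqP => [->|_]; last by rewrite mul0r.
by rewrite gauss0 mulr1.
Qed.

Lemma psum_conv_latgauss w v g c k : 0 < w -> 0 < v ->
  psum (fun m => gauss w m%:~R * latgauss v g (k - c * m)).
Proof.
move=> w0 v0; apply: psum_le (psum_gauss0 w0) => m.
  by rewrite mulr_ge0 ?gauss_ge0 ?latgauss_ge0.
rewrite ler_piMr ?gauss_ge0// (le_trans (latgauss_le _ _ _))//.
exact: gauss_le1.
Qed.

(** Division by the gcd leaves coprime [g1] and [c1]. A Bezout coefficient gives one solution, and
    two solutions differ by a multiple of [g1]. *)
Lemma dvdz_sub_mul_solutions g c k : 0 < g -> (gcdz g c %| k)%Z ->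
  exists m0, forall m, (g %| k - c * m)%Z <->
    exists n, m = m0 + (g %/ gcdz g c)%Z * n.
Proof.
move=> g0 /dvdzP[k' ->].
have [u [v uv]] := Bezoutz g c.
set d := gcdz g c in uv *.
have d0 : d != 0 by rewrite gcdz_eq0 negb_and gt_eqF.
have [g1 gE] : exists g1, g = g1 * d by apply/dvdzP; exact: dvdz_gcdl.
have [c1 cE] : exists c1, c = c1 * d by apply/dvdzP; exact: dvdz_gcdr.
have gd : (g %/ d)%Z = g1 by rewrite gE mulzK.
have uv1 : u * g1 + v * c1 = 1.
  by apply: (mulIf d0); rewrite mulrDl -!mulrA -gE -cE mul1r.
rewrite gd; exists (v * k') => m.
have cop : coprimez g1 c1 by apply/coprimezP; exists (u, v).
have E : k' * d - c * m = (k' * u * g1 - c1 * (m - v * k')) * d.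
  have -> : k' * d = k' * (u * g1 + v * c1) * d by rewrite uv1 mulr1.
  by rewrite {1}cE; ring.
have -> : (g %| k' * d - c * m)%Z = (g1 %| m - v * k')%Z.
  rewrite E {1}gE dvdz_mul2r// -[RHS](Gauss_dvdzr _ cop).
  by rewrite rpredBl//; apply: dvdz_mull; exact: dvdzz.
split=> [/dvdzP[n nE]|[n ->]]; first by exists n; rewrite [g1 * n]mulrC -nE addrC subrK.
by rewrite addrC addKr dvdz_mulr.
Qed.

(* Completing the square: given the sum k of two independent Gaussians, the
   first one is a Gaussian on a coset of a lattice. *)
Lemma conv_latgauss w v g c k : 0 < w -> 0 < v -> 0 < g ->
  exists a, zsum (fun m => gauss w m%:~R * latgauss v g (k - c * m)) =
    latgauss (w * c%:~R ^+ 2 + v) (gcdz g c) k *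
    theta (w * v * (gcdz g c)%:~R ^+ 2 / ((w * c%:~R ^+ 2 + v) * g%:~R ^+ 2)) a.
Proof.
move=> w0 v0 g0; set d := gcdz g c; set V := w * _ + v.
have d0 : d != 0 by rewrite gcdz_eq0 negb_and gt_eqF.
have V0 : 0 < V by rewrite ltr_wpDl// mulr_ge0 ?sqr_ge0// ltW.
(* Outside the lattice generated by [g] and [c] both sides vanish, whatever the offset. *)
case: (boolP (d %| k)%Z) => dk; last first.
  exists 0; rewrite /latgauss (negbTE dk) !mul0r.
  rewrite (_ : (fun m => _) = (fun m => 0 * gauss w m%:~R)).
    by rewrite zsumZ ?mul0r//; exact: psum_gauss0.
  apply/funext => m; rewrite (_ : (g %| _)%Z = false) ?mul0r ?mulr0//.
  apply: contraNF dk => H; rewrite -(subrK (c * m) k) rpredD//.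
    by apply: dvdz_trans H; exact: dvdz_gcdl.
  by rewrite dvdz_mulr// dvdz_gcdr.
have [m0 Hm] := dvdz_sub_mul_solutions g0 dk.
set g1 := (g %/ gcdz g c)%Z in Hm.
have gE : g = g1 * d by rewrite /g1 divzK// dvdz_gcdl.
have g10 : g1 != 0 by apply: contraTneq g0 => g1E; rewrite gE g1E mul0r ltxx.
(* Given the sum [k], the index [m] has mean [k c w / V] and variance [w v / V]. The substitution
   [m = m0 + g1 n] turns these into the offset [a] and the parameter of [theta]. *)
pose a : R := (m0%:~R - k%:~R * c%:~R * w / V) / g1%:~R.
exists a.
rewrite /latgauss dk mul1r -zsumZ ?gauss_ge0//; last first.
  have d2 : 0 < d%:~R ^+ 2 :> R by rewrite exprn_even_gt0//= intr_eq0.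
  have g2 : 0 < g%:~R ^+ 2 :> R by rewrite exprn_even_gt0//= intr_eq0 gt_eqF.
  apply: psum_gauss; apply: divr_gt0; first exact: mulr_gt0 (mulr_gt0 w0 v0) d2.
  exact: mulr_gt0.
have E1 : (fun m => gauss w m%:~R * ((g %| k - c * m)%Z%:R * gauss v (k - c * m)%:~R)) =
  (fun m => (g %| k - c * m)%Z%:R * (gauss w m%:~R * gauss v (k - c * m)%:~R)).
  by apply/funext => m; rewrite mulrCA.
rewrite E1 /zsum (@esumZ_inj _ (fun n => m0 + g1 * n) _ (fun m => (g %| k - c * m)%Z));
  last first.
- exact: Hm.
- by move=> m n /addrI /(mulfI g10).
congr fine; congr esumZ; apply/funext => n /=.
rewrite /gauss -!expRD; congr expR.
rewrite gE !(intrD, intrM, intrN) /a /V.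
have dn : d%:~R != 0 :> R by rewrite intr_eq0.
have g1n : g1%:~R != 0 :> R by rewrite intr_eq0.
move: (d%:~R : R) (g1%:~R : R) dn g1n => D G dn g1n.
by field; rewrite dn g1n !gt_eqF.
Qed.

(** The offset in [conv_latgauss] depends on [k]. Applying [theta_ratio] in both directions replaces
    it by 0 at the cost of a factor [r]. *)
Lemma theta_coset_bounds w v g c k : 0 < w -> 0 < v -> 0 < g -> 
  let V := w * c%:~R ^+ 2 + v in
  let d := gcdz g c in
  let t := w * v * d%:~R ^+ 2 / (V * g%:~R ^+ 2) in
  let r := 1 + 8 * expR (- (4 * t)) in
  let S := zsum (fun m => gauss w m%:~R * latgauss v g (k - c * m)) in
  1 <= t ->
  S <= r * theta t 0 * latgauss V d k /\ theta t 0 * latgauss V d k <= r * S.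
Proof.
move=> w0 v0 g0 V d t r S t1; rewrite /S.
have [a ->] := conv_latgauss c k w0 v0 g0; rewrite -/V -/d -/t.
have l0 := latgauss_ge0 V d k.
split; first by rewrite mulrC ler_wpM2r//; exact: theta_ratio.
by rewrite [r * _]mulrCA [leLHS]mulrC ler_wpM2l//; exact: theta_ratio.
Qed.

Lemma mass_conv_latgauss w v g c : 0 < w -> 0 < v ->
  psum (fun k => zsum (fun m => gauss w m%:~R * latgauss v g (k - c * m))) /\
  zsum (fun k => zsum (fun m => gauss w m%:~R * latgauss v g (k - c * m))) =
  theta w 0 * zsum (latgauss v g).
Proof.
move=> w0 v0.
have shifts m : psum (fun k => latgauss v g (k - c * m)).
  exact: (reindex_psum (addZ_bij (- (c * m))) (psum_latgauss g v0)).
have shiftE m : zsum (fun k => latgauss v g (k - c * m)) = zsum (latgauss v g).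
  by rewrite -(reindex_zsum (latgauss v g) (addZ_bij (- (c * m)))).
have rowE m : zsum (fun k => gauss w m%:~R * latgauss v g (k - c * m)) =
    zsum (latgauss v g) * gauss w m%:~R.
  by rewrite zsumZ ?gauss_ge0// shiftE mulrC.
have H0 : 0 <= zsum (latgauss v g) by exact/zsum_ge0/psum_latgauss.
have Fs m : psum (fun k => gauss w m%:~R * latgauss v g (k - c * m)).
  exact: psumZ (gauss_ge0 _ _) (shifts m).
have Ss : psum (fun m => zsum (fun k => gauss w m%:~R * latgauss v g (k - c * m))).
  by apply: eq_psum (psumZ H0 (psum_gauss0 w0)) => m; rewrite rowE.
have [_ [P <-]] := zsum_exchange Fs Ss; split=> //.
by rewrite (eq_zsum rowE) zsumZ ?zsum_gauss0 1?mulrC//; exact: psum_gauss0.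
Qed.

(** One factor of the square bounds the value at [k]. The other bounds the normalising constant, by
    summing the reverse inequality over all integers; [theta t 0] then cancels. *)
Lemma conv_latgauss_normalized w v g c k : 0 < w -> 0 < v -> 0 < g ->
  let V := w * c%:~R ^+ 2 + v in
  let d := gcdz g c in
  let t := w * v * d%:~R ^+ 2 / (V * g%:~R ^+ 2) in
  1 <= t ->
  zsum (latgauss V d) * zsum (fun m => gauss w m%:~R * latgauss v g (k - c * m)) <=
  (1 + 8 * expR (- (4 * t))) ^+ 2 * theta w 0 * zsum (latgauss v g) * latgauss V d k.
Proof.
move=> w0 v0 g0 V d t t1; set r := 1 + _.
have r0 : 0 <= r by rewrite addr_ge0// mulr_ge0// expR_ge0.
have V0 : 0 < V by rewrite ltr_wpDl// mulr_ge0 ?sqr_ge0// ltW.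
have Hs := psum_latgauss d V0.
have [Ps PE] := mass_conv_latgauss g c w0 v0.
have th0 : 0 <= theta t 0 by apply: theta_ge0; lra.
have M : theta t 0 * zsum (latgauss V d) <= r * (theta w 0 * zsum (latgauss v g)).
  rewrite -zsumZ// -PE -zsumZ//; apply: zsum_le; [exact: psumZ|exact: psumZ|].
  by move=> j; have [] := theta_coset_bounds j w0 v0 g0 t1.
have [U _] := theta_coset_bounds k w0 v0 g0 t1.
have l0 := latgauss_ge0 V d k; have H0 := zsum_ge0 Hs.
apply: le_trans (ler_wpM2l H0 U) _; rewrite -/V -/d -/t -/r.
rewrite [leLHS](_ : _ = r * (theta t 0 * zsum (latgauss V d)) * latgauss V d k);
  last by ring.
apply: le_trans (ler_wpM2r l0 (ler_wpM2l r0 M)) _.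
by rewrite le_eqVlt; apply/orP; left; apply/eqP; ring.
Qed.

End LatticeGauss.

(** * Law of an integer combination of the errors *)

Section DotLaw.
Context {R : realType} {T : finType}.
Variables (f : T -> int) (chi : T -> R).

Definition dot n (c : 'I_n -> int) (e : 'cV[T]_n) : int := \sum_i c i * f (e i 0).

Definition expect_dot n (c : 'I_n -> int) (F : int -> R) : R :=
  \sum_(e : 'cV[T]_n) iid_vec chi e * F (dot c e).

Lemma expect_dot0 (c : 'I_0 -> int) F : expect_dot c F = F 0.
Proof.
pose e0 : 'cV[T]_0 := \col_(i < 0) (False_rect T (notF (ltn_ord i))).
rewrite /expect_dot (big_pred1 e0); last first.
  by move=> e; apply/esym/eqP/matrixP => -[].
by rewrite /iid_vec /dot !big_ord0 mul1r.
Qed.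

Lemma expect_dot_recl n (c : 'I_n.+1 -> int) F :
  expect_dot c F = \sum_m chi m *
    expect_dot (c \o lift ord0) (fun t => F (c ord0 * f m + t)).
Proof.
under [RHS]eq_bigr do rewrite mulr_sumr.
rewrite pair_big /=.
pose h (p : T * 'cV[T]_n) : 'cV[T]_n.+1 :=
  \col_i (if unlift ord0 i is Some j then p.2 j 0 else p.1).
have hb : {on [pred e | true], bijective h}.
  apply: onW_bij.
  exists (fun e : 'cV[T]_n.+1 => (e ord0 0, \col_j e (lift ord0 j) 0)) => [[m e]|e] /=.
    congr pair; first by rewrite mxE unlift_none.
    by apply/matrixP => i j; rewrite !mxE liftK (ord1 j).
  apply/matrixP => i j; rewrite !mxE (ord1 j).
  by case: unliftP => [k ->|->]; rewrite ?mxE.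
rewrite /expect_dot (reindex h hb); apply: eq_big => // -[m e] _ /=.
have h0 : h (m, e) ord0 0 = m by rewrite mxE unlift_none.
have hl i : h (m, e) (lift ord0 i) 0 = e i 0 by rewrite mxE liftK.
rewrite /iid_vec /dot !big_ord_recl h0.
rewrite (eq_bigr (fun i => chi (e i 0))) => [|i _]; last by rewrite hl.
rewrite [X in F (_ + X)](eq_bigr (fun i => c (lift ord0 i) * f (e i 0))) => [|i _].
  by rewrite mulrA.
by rewrite hl.
Qed.

Definition law n (c : 'I_n -> int) (k : int) : R :=
  expect_dot c (fun t => (t == k)%:R).

Lemma law_recl n (c : 'I_n.+1 -> int) k :
  law c k = \sum_m chi m * law (c \o lift ord0) (k - c ord0 * f m).
Proof.
rewrite /law expect_dot_recl; apply: eq_bigr => m _; congr (_ * _).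
by apply: eq_bigr => e _;
  rewrite addrC -subr_eq subr_eq addrC -[in RHS]subr_eq opprK addrC.
Qed.

Lemma Pr_dot n (c : 'I_n -> int) (A : pred int) :
  Pr (iid_vec chi) [pred e | A (dot c e)] = expect_dot c (fun t => (A t)%:R).
Proof.
rewrite /Pr /expect_dot big_mkcond; apply: eq_bigr => e _.
by rewrite inE /=; case: (A _); rewrite ?mulr1 ?mulr0.
Qed.

Lemma expect_dot_sum_law n (c : 'I_n -> int) (s : seq int) : uniq s ->
  expect_dot c (fun t => (t \in s)%:R) = \sum_(k <- s) law c k.
Proof.
move=> us; rewrite /law /expect_dot exchange_big; apply: eq_bigr => e _ /=.
rewrite -mulr_sumr; congr (_ * _).
elim: s us => [|k s IH] /=; first by rewrite big_nil.
move=> /andP[ks us]; rewrite big_cons -IH// inE.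
by case: eqP => [->|_]; rewrite ?add0r// (negbTE ks) addr0.
Qed.

Hypothesis chi_ge0 : forall m, 0 <= chi m.
Hypothesis chi_sum1 : \sum_m chi m = 1.

Lemma expect_dot_le n (c : 'I_n -> int) F G : (forall t, F t <= G t) ->
  expect_dot c F <= expect_dot c G.
Proof.
move=> FG; apply: ler_sum => e _; apply: ler_wpM2l => //.
exact: prodr_ge0.
Qed.

Lemma expect_dot_cst n (c : 'I_n -> int) x : expect_dot c (fun=> x) = x.
Proof.
elim: n c => [|n IH] c; first exact: expect_dot0.
rewrite expect_dot_recl; under eq_bigr do rewrite IH.
by rewrite -mulr_suml chi_sum1 mul1r.
Qed.

Lemma expect_dot_zero n (c : 'I_n -> int) F : (forall i, c i = 0) ->
  expect_dot c F = F 0.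
Proof.
move=> c0; rewrite -[RHS](expect_dot_cst c); apply: eq_bigr => e _.
by rewrite /dot big1// => i _; rewrite c0 mul0r.
Qed.

Lemma expect_dotD n (c : 'I_n -> int) F G :
  expect_dot c (fun t => F t + G t) = expect_dot c F + expect_dot c G.
Proof.
by rewrite /expect_dot -big_split; apply: eq_bigr => e _; rewrite mulrDr.
Qed.

End DotLaw.

(** * Norm, gcd and support of the coefficient vector *)

Section CoefficientVectors.
Variable n : nat.
Implicit Types c : 'I_n -> int.

Definition sqnorm n (c : 'I_n -> int) : int := \sum_i c i ^+ 2.

Definition gcdf n (c : 'I_n -> int) : int := \big[gcdz/0]_i c i.

Definition nnz n (c : 'I_n -> int) : nat := \sum_i (c i != 0)%N.

Lemma gcdf_ge0 c : 0 <= gcdf c.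
Proof.
rewrite /gcdf; elim: (index_enum _) => [|i s IH]; first by rewrite big_nil.
by rewrite big_cons.
Qed.

Lemma gcdf_dvd c i : (gcdf c %| c i)%Z.
Proof.
rewrite /gcdf; have : i \in index_enum 'I_n by rewrite mem_index_enum.
elim: (index_enum _) => // j s IH; rewrite inE big_cons => /predU1P[->|/IH h].
  exact: dvdz_gcdl.
by apply: dvdz_trans h; exact: dvdz_gcdr.
Qed.

(** A nonzero coefficient is at least the gcd in absolute value. This makes the theta parameter grow
    linearly with the number of coefficients met. *)
Lemma nnz_gcdf_le c : (nnz c)%:Z * gcdf c ^+ 2 <= sqnorm c.
Proof.
rewrite /nnz -natz natr_sum mulr_suml; apply: ler_sum => i _.
case: eqP => [->|/eqP ci0]; first by rewrite mul0r sqr_ge0.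
have /dvdzP[q qE] := gcdf_dvd c i.
rewrite mul1r qE exprMn ler_peMl ?sqr_ge0//.
have q0 : q != 0 by apply: contra_neq ci0 => q0; rewrite qE q0 mul0r.
by move: q0; rewrite expr2; clear; nia.
Qed.

Lemma sqnorm_ge0 c : 0 <= sqnorm c.
Proof. by apply: sumr_ge0 => i _; exact: sqr_ge0. Qed.

Lemma nnz_le_sqnorm c : (nnz c)%:Z <= sqnorm c.
Proof.
rewrite /nnz -natz natr_sum; apply: ler_sum => i _.
case: eqP => [->|/eqP ci0]; first by rewrite sqr_ge0.
by move: (c i) ci0 => a; rewrite expr2; clear; nia.
Qed.

Lemma sqnorm_eq0 c : sqnorm c = 0 -> forall i, c i = 0.
Proof.
move=> /eqP; rewrite psumr_eq0; last by move=> i _; exact: sqr_ge0.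
by move=> /allP h i; apply/eqP; have := h i (mem_index_enum i); rewrite /= sqrf_eq0.
Qed.

Lemma nnz_eq0 c : (forall i, c i = 0) -> nnz c = 0%N /\ gcdf c = 0.
Proof.
move=> c0; split; first by rewrite /nnz big1// => i _; rewrite c0.
rewrite /gcdf; elim: (index_enum _) => [|i s IH]; first by rewrite big_nil.
by rewrite big_cons c0 IH.
Qed.

Lemma gcdf_eq0 c : gcdf c = 0 -> sqnorm c = 0.
Proof.
move=> g0; rewrite /sqnorm big1// => i _; have := gcdf_dvd c i.
by rewrite g0 dvd0z => /eqP ->.
Qed.
End CoefficientVectors.

(** * Pointwise upper bound for the law of the combination *)

Section LawBound.
Context {R : realType} {T : finType}.
Variables (f : T -> int) (w Z : R).
Hypothesis finj : injective f.
Hypothesis w0 : 0 < w.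
Hypothesis Z0 : 0 < Z.
Let chi (m : T) : R := gauss w (f m)%:~R / Z.
Hypothesis chi_sum1 : \sum_m chi m = 1.

Lemma gauss_scale (c0 m : int) : c0 != 0 ->
  gauss (w * (c0 ^+ 2)%:~R) (c0 * m)%:~R = gauss w m%:~R :> R.
Proof.
move=> c0n; rewrite /gauss; congr expR.
rewrite rmorphXn intrM /=.
have : c0%:~R != 0 :> R by rewrite intr_eq0.
by move: (c0%:~R : R) => x x0; field; rewrite x0 gt_eqF.
Qed.

(** [f] is injective, so the left side is part of a nonnegative sum over all integers. *)
Lemma sum_chi_le (G : int -> R) : (forall k, 0 <= G k <= 1) ->
  \sum_m chi m * G (f m) <= zsum (fun k => gauss w k%:~R * G k) / Z.
Proof.
move=> G01; rewrite ler_pdivlMr// mulr_suml.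
have Gs : psum (fun k => gauss w k%:~R * G k).
  apply: psum_le (psum_gauss0 w0) => k; have /andP[G0 G1] := G01 k.
    by rewrite mulr_ge0// gauss_ge0.
  by rewrite ler_piMr ?gauss_ge0.
apply: le_trans (@le_seq_zsum _ _ [seq f m | m <- index_enum T] Gs _); last first.
  by rewrite map_inj_uniq// index_enum_uniq.
rewrite big_map le_eqVlt; apply/orP; left; apply/eqP; apply: eq_bigr => m _.
by rewrite /chi mulrAC divfK ?gt_eqF.
Qed.

(** The factor of [conv_latgauss_normalized], with [t] replaced by its lower bound [j y]. *)
Definition conv_error (y : R) (j : nat) : R := (1 + 8 * expR (- (4 * (j%:R * y)))) ^+ 2.

(** Induction on the dimension, splitting off the first coordinate. Each nonzero coefficient pays
    [theta w 0 / Z] for the truncation. Each except the first one met also pays [conv_error] at the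
    number of those already met, so the product starts at 1. *)
Lemma law_le n (c : 'I_n -> int) (y : R) k :
  1 <= y -> y * (sqnorm c)%:~R <= w ->
  let V := w * (sqnorm c)%:~R in
  zsum (latgauss V (gcdf c)) * law f chi c k <=
  (theta w 0 / Z) ^+ nnz c * (\prod_(1 <= j < nnz c) conv_error y j) *
  latgauss V (gcdf c) k.
Proof.
move=> y1; elim: n c k => [|n IH] c k /= yw.
  rewrite /sqnorm /gcdf /nnz !big_ord0 big_geq// expr0 !mul1r mulr0.
  rewrite /law expect_dot0 (eq_zsum latgauss00) latgauss00 eq_sym.
  have -> : zsum (fun k0 : int => (k0 == 0)%:R) = 1 :> R.
    by rewrite -[RHS](psum_pred1 0 (ler01 : 0 <= 1 :> R)).2; apply: eq_zsum => j;
      rewrite mulr1.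
  by rewrite mul1r.
set c' := c \o lift ord0; set c0 := c ord0.
have sqE : sqnorm c = c0 ^+ 2 + sqnorm c' by rewrite /sqnorm big_ord_recl.
have gE : gcdf c = gcdz c0 (gcdf c') by rewrite /gcdf big_ord_recl.
have nE : nnz c = ((c0 != 0) + nnz c')%N by rewrite /nnz big_ord_recl.
have yw' : y * (sqnorm c')%:~R <= w.
  apply: le_trans yw; rewrite ler_wpM2l ?(le_trans ler01)// ler_int sqE.
  by rewrite lerDr sqr_ge0.
have {}IH j := IH c' j yw'.
have lawE : law f chi c k = \sum_m chi m * law f chi c' (k - c0 * f m).
  exact: law_recl.
have chi0 m : 0 <= chi m by rewrite divr_ge0 ?gauss_ge0// ltW.
have [c00|c0n] := eqVneq c0 0.
  rewrite c00 in sqE gE nE lawE.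
  rewrite lawE (eq_bigr (fun m => chi m * law f chi c' k)); last first.
    by move=> m _; rewrite mul0r subr0.
  rewrite -mulr_suml chi_sum1 mul1r.
  rewrite sqE gE nE eqxx add0n expr0n add0r gcdzC gcdz0 abszE ger0_norm ?gcdf_ge0//.
(* When all other coefficients vanish, [k] has at most one preimage and the law is a scaled copy of
   [chi], without convolution error. *)
have [A0|A0] := eqVneq (sqnorm c') 0.
  have cz := sqnorm_eq0 A0; have [n'0 g'0] := nnz_eq0 cz.
  rewrite nE n'0 c0n addn0 big_geq// mulr1 expr1.
  rewrite sqE A0 addr0 gE g'0 gcdz0 abszE.
  have lE j : law f chi c' j = (j == 0)%:R.
    by rewrite /law expect_dot_zero// eq_sym.
  have ndvd m : (`|c0| %| m)%Z = (c0 %| m)%Z by rewrite -abszE.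
  have Hsum : zsum (latgauss (w * (c0 ^+ 2)%:~R) `|c0|) = theta w 0.
    rewrite -zsum_gauss0 /zsum; congr fine.
    rewrite /latgauss (@esumZ_inj _ (fun m => c0 * m) _ (fun k => (`|c0| %| k)%Z)).
    - by congr esumZ; apply/funext => m /=; exact: gauss_scale.
    - exact: mulfI.
    - move=> m; rewrite ndvd; split=> [/dvdzP[q ->]|[q ->]].
        by exists q; rewrite mulrC.
      by rewrite dvdz_mulr.
  rewrite Hsum lawE [leRHS]mulrAC -[leRHS]mulrA ler_wpM2l ?theta_ge0//.
  rewrite ler_pdivlMr// mulr_suml.
  rewrite (eq_bigr (fun m => gauss w (f m)%:~R * (k - c0 * f m == 0)%:R)); last first.
    by move=> m _; rewrite lE mulrAC /chi divfK// gt_eqF.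
  have [m km|no] := pickP (fun m => k - c0 * f m == 0); last first.
    rewrite big1 ?latgauss_ge0// => m _; rewrite no mulr0//.
  rewrite (bigD1 m)//= km mulr1 big1 ?addr0.
    have -> : k = c0 * f m by apply/eqP; rewrite -subr_eq0.
    by rewrite /latgauss ndvd dvdz_mulr// mul1r gauss_scale.
  move=> m' m'm; case: eqP => [km'|]; last by rewrite mulr0.
  case/eqP: m'm; apply: finj; apply: (mulfI c0n); apply/eqP.
  by rewrite -subr_eq0 -(subKr k (c0 * f m)) (eqP km) subr0 -opprB km' oppr0.
have A0p : 0 < sqnorm c' by rewrite lt_neqAle eq_sym A0 sqnorm_ge0.
have g'p : 0 < gcdf c'.
  rewrite lt_neqAle gcdf_ge0 andbT eq_sym; apply: contra_neq A0; exact: gcdf_eq0.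
set v := w * (sqnorm c')%:~R.
have v0 : 0 < v by rewrite mulr_gt0 ?ltr0z.
have VE : w * (sqnorm c)%:~R = w * c0%:~R ^+ 2 + v.
  by rewrite sqE intrD rmorphXn mulrDr.
have J0 : (0 < nnz c')%N.
  rewrite lt0n; apply: contra_neq A0 => n0; rewrite /sqnorm big1// => i _.
  move/eqP: n0; rewrite /nnz sum_nat_eq0 => /forallP/(_ i).
  by rewrite /= eqb0 negbK => /eqP ->.
rewrite gE gcdzC VE; set d := gcdz _ _; set V := w * _ + v in VE *.
set t := w * v * d%:~R ^+ 2 / (V * (gcdf c')%:~R ^+ 2).
have V0 : 0 < V by rewrite -VE mulr_gt0// ltr0z sqE ltr_wpDl// sqr_ge0.
(* As [v / V] is a ratio of squared norms, [t] is the product of [w / |c|^2], [|c'|^2 / (gcdf c')^2]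
   and [d^2]; these are at least [y], [nnz c'] and 1. *)
have tJ : (nnz c')%:R * y <= t.
  have g'2 : 0 < (gcdf c')%:~R ^+ 2 :> R by rewrite exprn_gt0// ltr0z.
  rewrite ler_pdivlMr; last exact: mulr_gt0.
  have d1 : 1 <= d%:~R ^+ 2 :> R.
    rewrite exprn_ege1// ler1z -gtz0_ge1 lt_neqAle eq_sym gcdz_eq0 negb_and.
    by rewrite gt_eqF//=.
  have Jg : (nnz c')%:R * (gcdf c')%:~R ^+ 2 <= (sqnorm c')%:~R :> R.
    by have := nnz_gcdf_le c'; rewrite -(ler_int R) intrM rmorphXn.
  rewrite -VE [leLHS](_ : _ = w * (((nnz c')%:R * (gcdf c')%:~R ^+ 2) * (y * (sqnorm
    c)%:~R))); last by ring.
  rewrite /v [leRHS](_ : _ = w * (((sqnorm c')%:~R * w) * d%:~R ^+ 2)); last by ring.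
  rewrite ler_wpM2l ?(ltW w0)//.
  have Aw0 : 0 <= (sqnorm c')%:~R * w :> R by rewrite mulr_ge0 ?ler0z ?sqnorm_ge0 ?(ltW
    w0).
  apply: le_trans (ler_peMr Aw0 d1); apply: ler_pM => //.
    by rewrite mulr_ge0 ?ler0n ?(ltW g'2).
  by rewrite mulr_ge0 ?ler0z ?sqnorm_ge0// (le_trans ler01).
have t1 : 1 <= t.
  apply: le_trans tJ; apply: (le_trans y1); apply: ler_peMl; last by rewrite ler1n.
  exact: le_trans ler01 y1.
have step := conv_latgauss_normalized k w0 v0 g'p t1.
rewrite -/d -/V -/t in step.
set S := zsum (fun m => gauss w _ * _) in step.
have H0 : 0 < zsum (latgauss v (gcdf c')) by apply: lt_le_trans (zsum_latgauss_ge1 _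
  v0).
set H := zsum (latgauss v _) in step H0.
set D' : R := (theta w 0 / Z) ^+ nnz c' * \prod_(1 <= j < nnz c') conv_error y j.
have D'0 : 0 <= D'.
  rewrite mulr_ge0 ?exprn_ge0 ?divr_ge0 ?theta_ge0 ?(ltW Z0)//.
  by apply: prodr_ge0 => j _; exact: sqr_ge0.
(* The induction hypothesis is averaged over the first coordinate, whose range is then extended to
   all integers. *)
have lawS : H * law f chi c k <= D' * S / Z.
  rewrite lawE mulr_sumr.
  apply: (@le_trans _ _ (\sum_m D' * (chi m * latgauss v (gcdf c') (k - c0 * f m)))).
    apply: ler_sum => m _; rewrite mulrCA [leRHS]mulrCA ler_wpM2l//.
  rewrite -mulr_sumr -[leRHS]mulrA ler_wpM2l//.
  pose G j := latgauss v (gcdf c') (k - c0 * j).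
  have G01 j : 0 <= G j <= 1.
    by rewrite latgauss_ge0 (le_trans (latgauss_le _ _ _))// gauss_le1.
  exact: (sum_chi_le G01).
have S0 : 0 <= S by apply: zsum_ge0; exact: psum_conv_latgauss.
rewrite nE c0n /= add1n big_nat_recr//= exprS.
rewrite -(ler_pM2l H0).
have HV0 : 0 <= zsum (latgauss V d).
  by apply: zsum_ge0; exact: psum_latgauss.
rewrite mulrCA; apply: le_trans (ler_wpM2l HV0 lawS) _.
rewrite [leLHS](_ : _ = D' / Z * (zsum (latgauss V d) * S)); last by ring.
have D'Z0 : 0 <= D' / Z by rewrite divr_ge0 ?(ltW Z0).
apply: le_trans (ler_wpM2l D'Z0 step) _.
have errle : (1 + 8 * expR (- (4 * t))) ^+ 2 <= conv_error y (nnz c').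
  rewrite /conv_error lerXn2r ?nnegrE ?addr_ge0 ?mulr_ge0 ?expR_ge0//.
  by rewrite lerD2l ler_pM2l// ler_expR lerN2 ler_pM2l.
rewrite [leLHS](_ : _ = (D' * theta w 0 / Z * H * latgauss V d k) * (1 + 8 * expR (- (4
  * t))) ^+ 2); last by ring.
rewrite [leRHS](_ : _ = (D' * theta w 0 / Z * H * latgauss V d k) * conv_error y (nnz
  c')); last by rewrite /D'; ring.
apply: ler_wpM2l errle; apply: mulr_ge0 (latgauss_ge0 _ _ _).
apply: mulr_ge0 (ltW H0); apply: divr_ge0 (ltW Z0).
exact: mulr_ge0 D'0 (theta_ge0 0 w0).
Qed.
End LawBound.

(** * Smoothing parameter and truncation *)

Section Estimates.
Context {R : realType}.
Implicit Types (w y eps K : R).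

(** With [x = expR (- 4 y)], each factor is at most [expR (16 x^j)], and the geometric sum of the
    [x^j] is at most [2 x] because [x <= 1/2]. *)
Lemma prod_conv_error_le y J : 1 <= y ->
  \prod_(1 <= j < J) conv_error y j <= expR (32 * expR (- (4 * y))).
Proof.
move=> y1; rewrite big_add1 big_mkord.
set x := expR (- (4 * y)); have x0 : 0 < x by exact: expR_gt0.
have x2 : x <= 2^-1.
  by apply: le_trans expRN1_le; rewrite ler_expR lerN2; lra.
move: J.-1 => n.
have S : \sum_(i < n) x ^+ i.+1 <= 2 * x.
  apply: (@le_trans _ _ (2 * x * (1 - 2^-1 ^+ n))); last first.
    by rewrite ler_piMr ?mulr_ge0 ?(ltW x0)// gerBl exprn_ge0// invr_ge0.
  elim: n => [|n IH]; first by rewrite big_ord0 expr0 subrr mulr0.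
  rewrite big_ord_recr /=.
  have h : x ^+ n.+1 <= x * 2^-1 ^+ n.
    by rewrite exprS ler_pM2l// lerXn2r ?nnegrE ?invr_ge0 ?(ltW x0).
  apply: le_trans (lerD IH h) _; rewrite exprS le_eqVlt; apply/orP; left.
  by apply/eqP; field.
apply: (@le_trans _ _ (expR (16 * \sum_(i < n) x ^+ i.+1))); last first.
  by rewrite ler_expR; lra.
rewrite mulr_sumr expR_sum; apply: ler_prod => i _.
have -> : conv_error y i.+1 = (1 + 8 * x ^+ i.+1) ^+ 2.
  rewrite /conv_error (_ : - (4 * (i.+1%:R * y)) = i.+1%:R * - (4 * y)); last by ring.
  by rewrite expRM_natl.
rewrite sqr_ge0/=.
rewrite (_ : 16 * x ^+ i.+1 = 2%:R * (8 * x ^+ i.+1)); last by ring.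
rewrite expRM_natl lerXn2r ?nnegrE ?expR_ge0 ?addr_ge0 ?mulr_ge0 ?exprn_ge0 ?(ltW x0)//.
exact: expR_ge1Dx.
Qed.

Lemma pi_le4 : pi <= 4 :> R.
Proof. have := @pihalf_lt2 R; lra. Qed.

Lemma dual_intlattice : dual_lattice (intlattice R) = intlattice R.
Proof.
apply/seteqP; split => [y /= h|y /= [m _ <-] _ [k _ <-]]; last first.
  by exists (k * m); rewrite intrM.
have [] := h 1; first by exists 1.
by move=> k; rewrite mul1r => ->; exists k.
Qed.

(** Shows that the set in the definition of [smoothing] is nonempty; an empty set would have the
    default infimum 0. The term at [k] is at most [eps / 4] times [2^-|k|], and [zsum_geo] bounds
    the sum of these powers by 4. *)
Lemma gauss_sum_nonzero_le eps : 0 < eps < 1 ->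
  (\esum_(y in dual_lattice (intlattice R) `\ 0%R) (expR (- pi * (8 / eps * y) ^+ 2))%:E
     <= eps%:E)%E.
Proof.
move=> /andP[e0 e1].
rewrite dual_intlattice.
have -> : (intlattice R `\ 0 = (fun k : int => k%:~R : R) @` [set k | k != 0])%classic.
  apply/seteqP; split => [y /= [[k _ <-] k0]|y /= [k k0 <-]].
    by exists k => //; apply/eqP => kz; apply: k0; rewrite kz.
  split; first by exists k.
  by move=> /eqP; rewrite intr_eq0 (negbTE k0).
rewrite esum_image; last by move=> x y _ _ /intr_inj.
rewrite esum_mkcond.
apply: (@le_trans _ _ (esumZ (fun k => eps / 4 * 2^-1 ^+ `|k|%N))); last first.
  rewrite -zsumK; last by apply: psumZ psum_geo; rewrite divr_ge0// ltW.
  rewrite lee_fin (zsumZ (divr_ge0 (ltW e0) (ler0n _ 4)) psum_geo).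
  by rewrite -mulrA ler_piMr ?(ltW e0)// mulrC ler_pdivrMr// mul1r zsum_geo.
apply: le_esum => k _; case: ifPn; rewrite ?inE /=; last first.
  by move=> _; rewrite lee_fin mulr_ge0 ?divr_ge0 ?exprn_ge0 ?invr_ge0// ltW.
move=> k0; rewrite lee_fin.
have s1 : 8 <= 8 / eps by rewrite ler_peMr// invf_ge1 ?(ltW e1).
set s := 8 / eps in s1 *; pose x := expR (- s).
have m1 : (0 < `|k|)%N by rewrite absz_gt0.
apply: (@le_trans _ _ (x ^+ `|k|%N)).
  rewrite /x -expRM_natl ler_expR mulNr mulrN lerN2.
  have -> : (s * k%:~R) ^+ 2 = s ^+ 2 * ((`|k|%N)%:R) ^+ 2 :> R.
    by rewrite exprMn natr_absz intr_norm real_normK ?num_real.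
  have : 1 <= (`|k|%N)%:R :> R by rewrite ler1n.
  move: (_%:R : R) => m hm.
  have := @pi_ge2 R; move: (pi : R) => p hp.
  rewrite [leRHS](_ : _ = (m * s) * (p * s * m)); last by ring.
  have ps : 16 <= p * s by have := ler_pM (ler0n R 2) (ler0n R 8) hp s1; rewrite -natrM.
  have m0 : 0 <= m by lra.
  have s0 : 0 <= s by lra.
  apply: ler_peMr; first exact: mulr_ge0.
  have := ler_pM (ler0n R 16) ler01 ps hm; lra.
have xle : x <= eps / 8.
  rewrite /x expRN -[leRHS]invrK lef_pV2 ?posrE ?expR_gt0 ?invr_gt0 ?divr_gt0//.
  by rewrite invf_div -/s; have := expR_ge1Dx s; lra.
rewrite -(prednK m1) !exprS mulrA ler_pM ?exprn_ge0 ?(expR_ge0 (- s))//; first by lra.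
have x2 : x <= 2^-1 by clear -xle e1; lra.
by rewrite lerXn2r ?nnegrE ?expR_ge0 ?invr_ge0.
Qed.

(** The dual point 1 alone forces [expR (- pi s^2) <= eps] for every admissible [s]. This is a lower
    bound [l] on [s], and it passes to the infimum. *)
Lemma smoothing_intlattice_ge eps : 0 < eps < 1 ->
  expR (- (pi * smoothing (intlattice R) eps ^+ 2)) <= eps.
Proof.
move=> e01; have /andP[e0 e1] := e01.
set A := [set s : R | 0 < s /\
    (\esum_(y in dual_lattice (intlattice R) `\ 0%R) (expR (- pi * (s * y) ^+ 2))%:E
       <= eps%:E)%E]%classic.
have A8 : A (8 / eps).
  by split; [rewrite divr_gt0|exact: gauss_sum_nonzero_le].
have lneg : 0 <= - ln eps by rewrite oppr_ge0 ln_le0// ltW.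
pose l := Num.sqrt (- ln eps / pi).
have Al : lbound A l.
  move=> s [s0]; rewrite dual_intlattice => hs.
  have h : (expR (- pi * s ^+ 2) <= eps).
    rewrite -lee_fin; apply: le_trans hs; apply: esum_ge.
    exists [set 1]%classic; last by rewrite fsbig_set1 mulr1.
    split; first exact: finite_set1.
    move=> _ ->; split; first by exists 1.
    by apply/eqP; rewrite oner_eq0.
  have h2 : - ln eps / pi <= s ^+ 2.
    rewrite ler_pdivrMr ?pi_gt0// mulrC lerNl -mulNr -ler_expR lnK ?posrE//.
  by rewrite /l -(ger0_norm (ltW s0)) -sqrtr_sqr ler_wsqrtr.
have lS : l <= smoothing (intlattice R) eps.
  by apply: lb_le_inf => //; exists (8 / eps).
rewrite -[leRHS]lnK ?posrE// ler_expR lerNl -ler_pdivrMl ?pi_gt0// mulrC.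
rewrite -(sqr_sqrtr (_ : 0 <= - ln eps / pi)); last by rewrite divr_ge0 ?pi_ge0.
by rewrite -/l lerXn2r ?nnegrE ?sqrtr_ge0// (le_trans (sqrtr_ge0 _) lS).
Qed.

Lemma zsum_fset (A : {fset int}) (F : int -> R) : (forall k, 0 <= F k) ->
  psum (fun k => (k \in A)%:R * F k) /\
  zsum (fun k => (k \in A)%:R * F k) = \sum_(k <- A) F k.
Proof.
move=> F0.
have E : esumZ (fun k => (k \in A)%:R * F k) = (\sum_(k <- A) F k)%:E.
  transitivity (\esum_(k in [set` A]) (F k)%:E).
    rewrite [RHS]esum_mkcond; apply: eq_esum => k _.
    rewrite (_ : (k \in [set` A]%classic) = (k \in A)); last first.
      by apply/idP/idP; rewrite inE.
    by case: (k \in A); rewrite ?mul1r ?mul0r.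
  rewrite esum_fset//; last by move=> i _; rewrite lee_fin.
  by rewrite fsbig_finite// set_fsetK sumEFin.
have P : psum (fun k => (k \in A)%:R * F k).
  by split; [move=> k; rewrite mulr_ge0// ler0n|rewrite E ltry].
by split=> //; apply: EFin_inj; rewrite zsumK.
Qed.

Lemma psum_ind w (P : pred int) : 0 < w -> psum (fun k => (P k)%:R * gauss w k%:~R).
Proof.
move=> w0; apply: psum_le (psum_gauss0 w0) => k; case: (P k);
  by rewrite ?mul1r ?mul0r ?gauss_ge0.
Qed.

(** The gain comes from [k^2 - (k - L)^2 >= 2 a L]. *)
Lemma gauss_shift_le w (a : R) (k L : int) : 0 < w -> 0 <= L ->
  a <= (k - L)%:~R ->
  gauss w k%:~R <= expR (- (a * L%:~R / w)) * gauss w (k - L)%:~R.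
Proof.
move=> w0 L0 ak; rewrite /gauss -expRD ler_expR.
rewrite intrB in ak *; move: (L%:~R : R) (ler0z R L) ak => l; rewrite L0 => l0.
move: (k%:~R : R) => x ak.
rewrite [leRHS](_ : _ = (- (2 * a * l) - (x - l) ^+ 2) / (2 * w)); last first.
  by field; rewrite gt_eqF.
rewrite ler_pM2r ?invr_gt0 ?mulr_gt0//; nra.
Qed.

(* One shift of the tail by L suffices, since the tail occurs on both sides. *)
Lemma gauss_tail_le w (a b : R) (L : int) : 0 < w -> 0 <= L -> a <= b - L%:~R ->
  (1 - expR (- (a * L%:~R / w))) * zsum (fun k => (b <= k%:~R)%R%:R * gauss w k%:~R) <=
  expR (- (a * L%:~R / w)) * zsum (fun k => (b - L%:~R <= k%:~R < b)%R%:R * gauss w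
    k%:~R).
Proof.
move=> w0 L0 abL; set r := expR _; have r0 : 0 <= r by exact: expR_ge0.
set T := zsum _; set M := zsum _.
pose U := zsum (fun k => (b - L%:~R <= k%:~R)%R%:R * gauss w k%:~R).
have UE : U = T + M.
  rewrite -zsumD; [|exact: psum_ind|exact: psum_ind]; apply: eq_zsum => k.
  have [bk|kb] := leP b k%:~R; rewrite ?andbT ?andbF ?mul0r ?mul1r ?addr0 ?add0r//.
  by rewrite (le_trans _ bk) ?mul1r// gerBl ler0z.
suff : T <= r * U by rewrite UE; lra.
have Us := psum_ind (fun k => b - L%:~R <= k%:~R) w0.
rewrite /U (reindex_zsum _ (addZ_bij (- L))) -zsumZ//;
  last exact: (reindex_psum (addZ_bij (- L)) Us).
apply: zsum_le; [exact: psum_ind| |].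
  by apply: psumZ => //; exact: (reindex_psum (addZ_bij (- L)) Us).
move=> k /=; rewrite intrB lerD2r.
case: (leP b k%:~R) => bk; last by rewrite !mul0r mulr0.
by rewrite !mul1r -intrB gauss_shift_le// intrB; lra.
Qed.

End Estimates.

(** * Cost of truncating a coordinate to [Zq] *)

Section Truncation.
Context {R : realType}.
Variables (q : nat) (w K eps : R) (A : int).
Hypothesis q0 : (0 < q)%N.
Hypothesis A2 : 2 <= A.
Hypothesis wA : 16 * A%:~R <= w.
Hypothesis wq : w * (4 * A%:~R) < q%:R ^+ 2.

Let nc : R := Num.sqrt A%:~R.
Let Z : R := \sum_(k <- Zq q) gauss w k%:~R.
Let far (k : int) : bool := q%:R / 2 < nc * (`|k|%:~R : R).
Hypothesis far_small : \sum_(k <- Zq q | far k) gauss w k%:~R <= K * eps * Z.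

(** With [|c| = nc], the event [far] begins beyond [a], whereas the truncation happens at
    [b = a |c|]. The mass between the two controls the mass beyond [b]. *)
Let a : R := q%:R / (2 * nc).
Let b : R := q%:R / 2.

Let A2R : 2 <= A%:~R :> R. Proof. by rewrite (_ : 2 = 2%:~R)// ler_int. Qed.
Let w0 : 0 < w. Proof. have := wA; have := A2R; lra. Qed.
Let nc2 : nc ^+ 2 = A%:~R. Proof. by rewrite sqr_sqrtr//; have := A2R; lra. Qed.
Let nc0 : 0 < nc. Proof. by rewrite sqrtr_gt0; have := A2R; lra. Qed.
Let nc1 : 7 / 5 <= nc. Proof. have := nc2; have := nc0; have := A2R; nra. Qed.
Let q0R : 0 < q%:R :> R. Proof. by rewrite ltr0n. Qed.
Let a0 : 0 < a. Proof. by rewrite divr_gt0// mulr_gt0. Qed.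
Let ba : b = a * nc. Proof. by rewrite /a /b; field; rewrite gt_eqF. Qed.
Let a2 : w < a ^+ 2.
Proof.
have h : a ^+ 2 * (4 * A%:~R) = q%:R ^+ 2.
  by rewrite -nc2 /a; field; rewrite gt_eqF.
by move: wq; rewrite -h ltr_pM2r//; have := A2R; lra.
Qed.
Let anc : 4 * nc < a.
Proof.
have h : (4 * nc) ^+ 2 < a ^+ 2.
  by apply: le_lt_trans a2; rewrite exprMn nc2; have := wA; lra.
by rewrite -(@ltr_pXn2r _ 2)// nnegrE ltW// mulr_gt0.
Qed.
Let ba2 : 2 <= b - a.
Proof. rewrite ba; have := anc; have := nc1; nra. Qed.

Let farE k : far k = (a < `|k|%:~R).
Proof. by rewrite /far -/b ba mulrC ltr_pM2l. Qed.

Let half_le (k : int) : q%:Z <= k *+ 2 -> b <= k%:~R.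
Proof. by rewrite -(ler_int R) mulr2n intrD -pmulrn /b; lra. Qed.

(** The largest integer below [b - a] works; it is at least half of [b - a] because [b - a >= 2]. *)
Lemma exists_shift : exists L : int,
  [/\ 0 <= L, a < b - L%:~R & (b - a) / 2 <= L%:~R].
Proof.
have h1 := ceil_ge (b - a); have h2 := gt_pred_ceil (b - a).
exists (Num.ceil (b - a) - 1); rewrite intrB in h2 *; split.
- by rewrite -(ler_int R) intrB; have := ba2; lra.
- lra.
- by have := ba2; lra.
Qed.

(** The mass outside [Zq] is at most [2 T], with [T] the tail from [b] on. The window [[b - L, b)]
    of mass [M] and its mirror image consist of [far] points of [Zq], and [A T <= 16 M]. The factor
    [A] later pays for the number of coordinates. *)
Lemma outside_mass_le :
  A%:~R * (theta w 0 - Z) <= 16 * (K * eps * Z).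
Proof.
have [L [L0 abL LL]] := exists_shift.
have tl := gauss_tail_le w0 L0 (ltW abL).
set r := expR _ in tl; set T := zsum _ in tl;
  set M := zsum (fun k => (b - _ <= _ < b)%R%:R * _) in tl.
have r0 : 0 < r by exact: expR_gt0.
have T0 : 0 <= T by apply/zsum_ge0/psum_ind.
(* [a L / w] is at least [a (b - a) / (2 w) = a^2 (|c| - 1) / (2 w)], and [w < a^2]. *)
pose l := (nc - 1) / 2.
have lle : l <= a * L%:~R / w.
  rewrite ler_pdivlMr// /l.
  have := ler_wpM2l (ltW a0) LL; rewrite ba; have := a2; have := nc1; nra.
(* The quadratic term is what matches [A = (2 l + 1)^2]; a linear bound would gain only a factor
   [|c|]. *)
have rinv : 1 + l + l ^+ 2 / 4 <= r^-1.
  rewrite -expRN opprK; apply: le_trans (_ : expR l <= _); last by rewrite ler_expR.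
  rewrite (_ : l = 2%:R * (l / 2)); last by field.
  rewrite expRM_natl; apply: le_trans (_ : (1 + l / 2) ^+ 2 <= _); first by lra.
  rewrite lerXn2r ?nnegrE ?expR_ge0 ?expR_ge1Dx//.
  by rewrite /l; have := nc1; lra.
have TM : (l + l ^+ 2 / 4) * T <= M.
  have : (r^-1 - 1) * T <= M.
    by rewrite -(ler_pM2l r0) mulrA mulrBr mulfV ?gt_eqF// mulr1.
  apply: le_trans; apply: ler_wpM2r => //; lra.
have AT : A%:~R * T <= 16 * M.
  apply: (@le_trans _ _ (16 * ((l + l ^+ 2 / 4) * T))); last by rewrite ler_pM2l.
  rewrite mulrA; apply: ler_wpM2r => //.
  by rewrite -nc2 /l; have := nc1; nra.
have refl (P : pred int) : zsum (fun k => (P (0 - k))%:R * gauss w k%:~R) =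
    zsum (fun k => (P k)%:R * gauss w k%:~R).
  rewrite [RHS](reindex_zsum _ (subZ_bij 0)); apply: eq_zsum => k /=.
  by rewrite sub0r intrN gaussN.
have [Zs ZE] := zsum_fset (Zq q) (fun k => gauss_ge0 w k%:~R).
have out : theta w 0 <= Z + (T + T).
  have {2}-> : T = zsum (fun k => (b <= (0 - k)%:~R)%R%:R * gauss w k%:~R).
    by rewrite (refl (fun k => b <= k%:~R)).
  rewrite -zsum_gauss0 /Z -ZE -zsumD;
    [|exact: psum_ind|exact: (psum_ind (fun k => b <= (0 - k)%:~R))].
  rewrite -zsumD//; last first.
    by apply: psumD; [exact: psum_ind|exact: (psum_ind (fun k => b <= (0 - k)%:~R))].
  apply: zsum_le; first exact: psum_gauss0.
    apply: psumD => //.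
    by apply: psumD; [exact: psum_ind|exact: (psum_ind (fun k => b <= (0 - k)%:~R))].
  move=> k; have g0 := gauss_ge0 w k%:~R.
  rewrite -!mulrDl ler_peMl// -!natrD ler1n.
  case: (boolP (k \in Zq q)) => //; rewrite in_Zq negb_and -ltNge -leNgt => kout.
  suff : (b <= k%:~R) || (b <= (0 - k)%:~R) by case/orP => ->; rewrite ?addn1.
  case/orP: kout => h; apply/orP; [right|left]; apply: half_le.
    by move: h; rewrite !mulr2n; clear; lia.
  by [].
have MM : M + M <= \sum_(k <- Zq q | far k) gauss w k%:~R.
  have [Fs FE] := zsum_fset (Zq q) (F := fun k => (far k)%:R * gauss w k%:~R)
    (fun k => mulr_ge0 (ler0n _ _) (gauss_ge0 w k%:~R)).
  have -> : \sum_(k <- Zq q | far k) gauss w k%:~R =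
      \sum_(k <- Zq q) (far k)%:R * gauss w k%:~R.
    rewrite big_mkcond; apply: eq_bigr => k _.
    by case: (far k); rewrite ?mul1r ?mul0r.
  pose W (k : int) := b - L%:~R <= k%:~R < b.
  have {2}-> : M = zsum (fun k => (W (0 - k))%:R * gauss w k%:~R).
    by rewrite (refl W).
  rewrite -FE -zsumD; [|exact: psum_ind|exact: (psum_ind (fun k => W (0 - k)))].
  apply: zsum_le => //.
    by apply: psumD; [exact: psum_ind|exact: (psum_ind (fun k => W (0 - k)))].
  move=> k; have g0 := gauss_ge0 w k%:~R.
  rewrite mulrA -mulrDl ler_wpM2r// -natrM -natrD ler_nat -/(W k).
  have WP j : W j -> [/\ 0 < j, j *+ 2 < q%:Z & far j].
    move=> /andP[W1 W2]; have jpos : 0 < j by rewrite -(ltr0z R); have := a0; lra.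
    split => //; last by rewrite farE gtr0_norm//; lra.
    by rewrite ltNge; apply/negP => /half_le; lra.
  have farN j : far (- j) = far j by rewrite /far normrN.
  case: (boolP (W k)) => [/WP[k0 kq kf]|_].
    rewrite (_ : W (0 - k) = false); last by apply/negP => /WP[+ _ _]; move: k0; clear;
      lia.
    have kZ : k \in Zq q by rewrite in_Zq; move: k0 kq; rewrite !mulr2n; clear; lia.
    by rewrite kZ kf.
  case: (boolP (W (0 - k))) => // /WP[k0 kq].
  rewrite sub0r farN => kf.
  have kZ : k \in Zq q by rewrite in_Zq; move: k0 kq; rewrite !mulr2n; clear; lia.
  by rewrite kZ kf.
have A00 : 0 <= A%:~R :> R by have := A2R; lra.
have : A%:~R * (theta w 0 - Z) <= A%:~R * (T + T) by apply: ler_wpM2l => //; lra.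
have := far_small; lra.
Qed.

(** For even [q] the value [q / 2] is no overflow, yet it lies outside [Zq]. The Gaussian of
    variance [w A] there equals [gauss w a]. If [32 w^2 <= q^2] the exponent is large enough;
    otherwise the first integer beyond [a] is [far] and has a comparable weight. *)
Lemma atom_le (k : int) : k *+ 2 = q%:Z ->
  gauss (w * A%:~R) k%:~R <= expR (- (4 * (w / A%:~R))) + expR 4 * (K * eps * Z).
Proof.
move=> kq.
have kb : k%:~R = b.
  have := congr1 (fun x : int => x%:~R : R) kq.
  by rewrite mulr2n intrD /b => h; rewrite -[q%:R]h; field.
have A0 : 0 < A%:~R :> R by have := A2R; lra.
have E : gauss (w * A%:~R) k%:~R = gauss w a.
  rewrite /gauss kb ba exprMn nc2; congr expR; field.
  by rewrite !gt_eqF.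
have Keps0 : 0 <= K * eps * Z.
  by apply: le_trans far_small; apply: sumr_ge0 => j _; exact: gauss_ge0.
have [big|small] := leP (32 * w ^+ 2) (q%:R ^+ 2).
  apply: (@le_trans _ _ (expR (- (4 * (w / A%:~R))))); last first.
    by rewrite lerDl mulr_ge0// expR_ge0.
  rewrite /gauss kb ler_expR mulNr lerN2 /b.
  rewrite [leRHS](_ : _ = q%:R ^+ 2 / (8 * w * A%:~R)); last by field; rewrite !gt_eqF.
  rewrite ler_pdivlMr ?mulr_gt0// [leLHS](_ : _ = 32 * w ^+ 2)//.
  by field; rewrite gt_eqF.
apply: (@le_trans _ _ (expR 4 * (K * eps * Z))); last by rewrite lerDr expR_ge0.
rewrite E.
pose x := Num.floor a + 1.
have x1 : a < x%:~R by exact: floorD1_gt.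
have x2 : x%:~R <= a + 1 by rewrite /x intrD lerD2r; exact: floor_le.
have xZ : x \in Zq q.
  have xb : x%:~R < b by have := ba2; lra.
  have x0 : 0 < x%:~R :> R by have := a0; lra.
  rewrite in_Zq; apply/andP; split.
    by move: x0; rewrite ltr0z mulr2n; clear; lia.
  rewrite -(ltr_int R) mulr2n intrD; move: xb; rewrite /b.
  by rewrite pmulrn; lra.
have farx : far x.
  rewrite farE; apply: lt_le_trans x1 _.
  by rewrite ler_int ler_norm.
have le1 : gauss w x%:~R <= K * eps * Z.
  apply: le_trans far_small; rewrite (big_rem x)//= farx lerDl.
  by apply: sumr_ge0 => j _; exact: gauss_ge0.
apply: le_trans (_ : expR 4 * gauss w x%:~R <= _); last by rewrite ler_pM2l ?expR_gt0.
rewrite /gauss -expRD ler_expR.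
rewrite [leRHS](_ : _ = (8 * w - x%:~R ^+ 2) / (2 * w)); last by field; rewrite gt_eqF.
rewrite ler_pM2r ?invr_gt0 ?mulr_gt0//.
(* From [x <= a + 1] and [a <= q / 2 <= 3 w] comes [x^2 - a^2 <= 2 a + 1 <= 8 w], whence the factor
   [expR 4]. *)
have q6 : q%:R <= 6 * w.
  rewrite -(@ler_pXn2r _ 2) ?nnegrE ?mulr_ge0 ?ler0n ?(ltW w0)//.
  by rewrite exprMn; have := sqr_ge0 w; lra.
have a3 : a <= q%:R / 2.
  by rewrite -/b ba ler_peMr ?(ltW a0)//; have := nc1; lra.
have w1 : 2 <= w by have := A2R; have := wA; lra.
have a00 := a0; nra.
Qed.

End Truncation.

(** * The residual test *)

Section CenteredMod.
Variable q : nat.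
Hypothesis q0 : (0 < q)%N.

Lemma cmodD (a z : int) : cmod q (a + z * q%:Z) = cmod q a.
Proof.
rewrite /cmod.
have -> : ((a + z * q%:Z)%:~R + q%:R / 2) / q%:R = (a%:~R + q%:R / 2) / q%:R + z%:~R :>
  rat.
  by rewrite intrD intrM; field; rewrite pnatr_eq0 -lt0n.
rewrite floorDrz ?intr_int// intrKfloor; ring.
Qed.

Lemma cmod_Zq (t : int) : t \in Zq q -> cmod q t = t.
Proof.
rewrite in_Zq => /andP[h1 h2]; rewrite /cmod (_ : Num.floor _ = 0) ?mul0r ?subr0//.
have qr : 0 < q%:R :> rat by rewrite ltr0n.
move: h1 h2; rewrite -(ler_int rat) -(ltr_int rat) mulr2n intrD intrN -pmulrn => h1 h2.
by apply: floor_def; rewrite ler_pdivlMr// ltr_pdivrMr//; apply/andP; split; lra.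
Qed.

(** Only [t = q / 2] is moved, to [- q / 2], and the test sees absolute values alone. *)
Lemma norm_cmod (t : int) : `|t| *+ 2 <= q%:Z -> `|cmod q t| = `|t|.
Proof.
move=> h; have [tq|tq] := eqVneq (t *+ 2) q%:Z.
  rewrite {1}(_ : t = - t + 1 * q%:Z); last by rewrite -tq; ring.
  rewrite cmodD cmod_Zq; last by rewrite in_Zq; move: h tq q0; rewrite !mulr2n; clear;
    lia.
  exact: normrN.
by rewrite cmod_Zq// in_Zq; move: h tq; rewrite !mulr2n; clear; lia.
Qed.

End CenteredMod.

(** * Distribution of the filtered residual under the null hypothesis *)

Section ResidualTest.
Context {R : realType}.

Lemma dot_residual (q M N : nat) (Tc : 'M[int]_(M, N)) (d : 'cV[int]_M)
    (e : 'cV[Zq q]_N) :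
  (d^T *m (Tc *m map_mx val e)) 0 0 = dot val (fun i => (Tc^T *m d) i 0) e.
Proof.
rewrite mulmxA (_ : d^T *m Tc = (Tc^T *m d)^T); last by rewrite trmx_mul trmxK.
by rewrite mxE; apply: eq_bigr => i _; rewrite !mxE.
Qed.

(** The filter makes [d^T P s] a multiple of [q], and the entrywise reductions change the result by
    further multiples of [q]; [cmod] ignores both. *)
Lemma filtered_residual (q v M N : nat) (r : int) (Tc : 'M[int]_(M, N))
    (P : 'M[int]_(M, v)) (s : 'cV[int]_v) (d : 'cV[int]_M) (e : 'cV[Zq q]_N) :
  (0 < q)%N -> mxcmod q (d^T *m P) = 0 ->
  (lincomb q d (enc_residual q P s r 0 (Tc *m map_mx val e))).2 =
  cmod q (dot val (fun i => (Tc^T *m d) i 0) e).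
Proof.
move=> q0 dP; rewrite /lincomb /enc_residual /= scaler0 addr0.
have mxq m n (U : 'M[int]_(m, n)) : exists V, U = mxcmod q U + q%:Z *: V.
  exists (\matrix_(i, j) Num.floor (((U i j)%:~R + q%:R / 2) / q%:R : rat)).
  by apply/matrixP => i j; rewrite !mxE /cmod mulrC subrK.
have [V VE] := mxq _ _ (P *m s + Tc *m map_mx val e).
have [W WE] := mxq _ _ (d^T *m P).
have E : (d^T *m mxcmod q (P *m s + Tc *m map_mx val e)) 0 0 =
    dot val (fun i => (Tc^T *m d) i 0) e + ((W *m s) 0 0 - (d^T *m V) 0 0) * q%:Z.
  rewrite (_ : mxcmod q _ = P *m s + Tc *m map_mx val e - q%:Z *: V); last first.
    by rewrite {2}VE addrK.
  rewrite mulmxBr mulmxDr [d^T *m (P *m s)]mulmxA WE dP add0r -scalemxAl -scalemxAr.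
  by rewrite -dot_residual [LHS]mxE [X in X + _]mxE !mxE; ring.
by rewrite E cmodD.
Qed.

Lemma quadform_res_cov (M N : nat) (sigma : R) (Tc : 'M[int]_(M, N)) (d : 'cV[int]_M) :
  quadform (res_cov sigma Tc) d =
  sigma ^+ 2 * (sqnorm (fun i => (Tc^T *m d) i 0))%:~R.
Proof.
rewrite /quadform /res_cov -scalemxAr -scalemxAl mxE; congr (_ * _).
set T := map_mx _ Tc; set D := map_mx _ d.
rewrite !mulmxA -[_ *m _ *m D]mulmxA (_ : D^T *m T = (T^T *m D)^T);
  last by rewrite trmx_mul trmxK.
have -> : T^T *m D = map_mx (fun k : int => k%:~R) (Tc^T *m d).
  apply/matrixP => i j; rewrite !mxE rmorph_sum /=; apply: eq_bigr => k _.
  by rewrite !mxE intrM.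
rewrite mxE /sqnorm rmorph_sum /=; apply: eq_bigr => i _.
by rewrite !mxE rmorphXn expr2.
Qed.

Lemma l2normE (n : nat) (c : 'cV[int]_n) :
  l2norm R c = Num.sqrt (sqnorm (fun i => c i 0))%:~R.
Proof.
by rewrite /l2norm /sqnorm rmorph_sum; congr Num.sqrt; apply: eq_bigr => i _;
  rewrite rmorphXn.
Qed.

Lemma dnormalE (q : nat) (w : R) (y : Zq q) :
  dnormal 0 w y = gauss w (val y)%:~R / \sum_(k <- Zq q) gauss w k%:~R.
Proof.
rewrite /dnormal big_seq_fsetE /= subr0; congr (_ / _).
by apply: eq_bigr => z _; rewrite subr0.
Qed.

Lemma sum_gauss_Zq_gt0 (q : nat) (w : R) : (0 < q)%N ->
  0 < \sum_(k <- Zq q) gauss w k%:~R.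
Proof.
move=> q0; have z : 0 \in Zq q by rewrite in_Zq mul0rn; lia.
rewrite (big_rem 0)//= ltr_pwDl ?gauss_gt0//.
by apply: sumr_ge0 => k _; exact: gauss_ge0.
Qed.

Lemma dnormal_ge0 (q : nat) (w : R) (y : Zq q) : 0 <= dnormal 0 w y.
Proof.
rewrite dnormalE divr_ge0 ?gauss_ge0//.
by apply: sumr_ge0 => k _; exact: gauss_ge0.
Qed.

Lemma Pr_dnormal (q : nat) (w : R) (P : pred int) :
  Pr (dnormal 0 w : Zq q -> R) [pred y | P (val y)] =
  (\sum_(k <- Zq q | P k) gauss w k%:~R) / \sum_(k <- Zq q) gauss w k%:~R.
Proof.
rewrite /Pr big_seq_fsetE /= mulr_suml; apply: eq_big => //= y _.
by rewrite dnormalE.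
Qed.

Lemma sum_dnormal (q : nat) (w : R) : (0 < q)%N ->
  \sum_(y : Zq q) dnormal 0 w y = 1.
Proof.
move=> q0; have := Pr_dnormal q w predT.
by rewrite divff => [<-//|]; rewrite gt_eqF// sum_gauss_Zq_gt0.
Qed.

Lemma Pr_dnormalC (q : nat) (w : R) (P : pred int) : (0 < q)%N ->
  Pr (dnormal 0 w : Zq q -> R) [pred y | ~~ P (val y)] =
  1 - Pr (dnormal 0 w : Zq q -> R) [pred y | P (val y)].
Proof.
move=> q0; have := sum_dnormal w q0.
rewrite (bigID (fun y : Zq q => P (val y))) /= => <-.
by rewrite /Pr [in RHS]addrC addrK.
Qed.

(** An integer vector of squared norm 1 has a single nonzero entry, equal to 1 or -1, and the
    symmetry of [F] absorbs the sign. *)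
Lemma expect_dot_unit (T : finType) (f : T -> int) (chi : T -> R) n
    (c : 'I_n -> int) (F : int -> R) : \sum_m chi m = 1 ->
  sqnorm c = 1 -> (forall m, F (- f m) = F (f m)) ->
  expect_dot f chi c F = \sum_m chi m * F (f m).
Proof.
move=> chi1 + Fsym; elim: n c => [|n IH] c.
  by rewrite /sqnorm big_ord0.
set c' := c \o lift ord0.
have -> : sqnorm c = c ord0 ^+ 2 + sqnorm c' by rewrite /sqnorm big_ord_recl.
move=> h; rewrite expect_dot_recl -/c'.
have [c00|c0n] := eqVneq (c ord0) 0.
  rewrite c00 expr0n add0r in h.
  rewrite (eq_bigr (fun m => chi m * expect_dot f chi c' F)); last first.
    move=> m _; congr (_ * _); congr expect_dot; apply/funext => t.
    by rewrite c00 mul0r add0r.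
  by rewrite -mulr_suml chi1 mul1r IH.
have s'0 := sqnorm_ge0 c'.
have c01 : 0 < c ord0 ^+ 2 by rewrite exprn_even_gt0.
have s'00 : sqnorm c' = 0 by move: h s'0 c01; clear; lia.
have c0sq : c ord0 ^+ 2 = 1 by rewrite s'00 addr0 in h.
apply: eq_bigr => m _; congr (_ * _).
rewrite expect_dot_zero//; last exact: sqnorm_eq0.
rewrite addr0; move/eqP: c0sq; rewrite sqrf_eq1 => /orP[]/eqP ->.
  by rewrite mul1r.
by rewrite mulN1r.
Qed.

(** The first [K] accounts for overflow. The exponential bounds the factor [D] of [upper_bound]; it
    multiplies [16 K + 32], from the deviation of [D] from 1, and [1 + expR 4 K], from the atom at
    [q / 2]. *)
Definition error_rate (K : R) : R :=
  K + expR (16 * K + 32) * (16 * K + 32 + 1 + expR 4 * K).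

(** The integer [t] either overflows, or lies in [Zq], or equals [q / 2]. The three contributions
    are bounded separately, the middle one by summing [law_le] over the event. *)
Lemma upper_bound (q N : nat) (c : 'I_N -> int) (w K eps : R) (P : pred int) :
  let chi : Zq q -> R := dnormal 0 w in
  (0 < q)%N -> 0 < eps < 1 -> gcdf c = 1 -> 2 <= sqnorm c ->
  16 * (sqnorm c)%:~R <= w ->
  w * (4 * (sqnorm c)%:~R) < q%:R ^+ 2 ->
  expR (- (4 * (w / (sqnorm c)%:~R))) <= eps ->
  Pr chi [pred z | q%:R / 2 < Num.sqrt (sqnorm c)%:~R * (`|val z|%:~R : R)] <= K * eps
    ->
  expect_dot val chi c (fun t => (q%:R / 2 < (`|t|%:~R : R))%R%:R) <= K * eps ->
  expect_dot val chi c (fun t => (P `|cmod q t|)%:R) <=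
  Pr (dnormal 0 (w * (sqnorm c)%:~R) : Zq q -> R) [pred y | P `|val y|]
  + error_rate K * eps.
Proof.
move=> chi q0 /andP[e0 e1] gc A2 wA wq ye hfar hover.
set A := sqnorm c in A2 wA wq ye hfar *; set V := w * A%:~R.
have A2R : 2 <= A%:~R :> R by rewrite (_ : 2 = 2%:~R)// ler_int.
have AR0 : 0 < A%:~R :> R by lra.
have w0 : 0 < w by lra.
have V0 : 0 < V by rewrite mulr_gt0//; lra.
pose Z : R := \sum_(k <- Zq q) gauss w k%:~R.
pose ZV : R := \sum_(k <- Zq q) gauss V k%:~R.
have Z0 : 0 < Z by exact: sum_gauss_Zq_gt0.
have ZV0 : 0 < ZV by exact: sum_gauss_Zq_gt0.
have chi0 m : 0 <= chi m by exact: dnormal_ge0.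
have chi1 : \sum_m chi m = 1 by exact: sum_dnormal.
have chiE : chi = fun m => gauss w (val m)%:~R / Z by apply/funext => m;
  exact: dnormalE.
have K0 : 0 <= K.
  rewrite -(pmulr_lge0 _ e0); apply: le_trans hfar; exact: sumr_ge0.
have far_small : \sum_(k <- Zq q | q%:R / 2 < Num.sqrt A%:~R * (`|k|%:~R : R)) gauss w
  k%:~R <= K * eps * Z.
  rewrite -ler_pdivrMr//.
  by rewrite (Pr_dnormal q w (fun k => q%:R / 2 < Num.sqrt A%:~R * (`|k|%:~R : R))) in
    hfar.
have outside := outside_mass_le q0 A2 wA wq far_small.
have atom := atom_le q0 A2 wA wq far_small.
rewrite -/Z -/V in outside atom.
pose H : R := theta V 0.
have HE : zsum (latgauss V (gcdf c)) = H.
  rewrite gc /H -zsum_gauss0; apply: eq_zsum => k; by rewrite /latgauss dvd1z mul1r.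
have HZV : ZV <= H by rewrite /H -zsum_gauss0; apply: le_fset_zsum; exact: psum_gauss0.
have HZ : Z <= H.
  apply: le_trans HZV; apply: ler_sum => k _.
  rewrite /gauss ler_expR !mulNr lerN2 ler_wpM2l ?sqr_ge0//.
  rewrite lef_pV2 ?posrE ?mulr_gt0// ler_pM2l// /V ler_peMr ?(ltW w0)//; lra.
have H0 : 0 < H by exact: lt_le_trans HZ.
have H1 : 1 <= H by rewrite -HE; exact: zsum_latgauss_ge1.
have y1 : 1 <= w / A%:~R by rewrite ler_pdivlMr; lra.
have yA : w / A%:~R * A%:~R <= w by rewrite divfK// gt_eqF//; lra.
(* [16 K] collects at most [A] truncation factors, each at most [expR (16 K eps / A)]; [32] comes
   from [prod_conv_error_le] and [expR (- 4 w / A) <= eps]. *)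
pose D : R := expR ((16 * K + 32) * eps).
have D0 : 0 < D by exact: expR_gt0.
have lawb k : law val chi c k <= D * (gauss V k%:~R / H).
  rewrite mulrA ler_pdivlMr// mulrC.
  have := @law_le R (Zq q) val w Z val_inj w0 Z0.
  rewrite chiE in chi1; move=> /(_ chi1 N c (w / A%:~R) k y1 yA) /=.
  rewrite -chiE -/A -/V HE => /le_trans; apply.
  rewrite /latgauss gc dvd1z mul1r ler_wpM2r ?gauss_ge0//.
  rewrite /D mulrDl expRD ler_pM ?exprn_ge0 ?divr_ge0 ?theta_ge0 ?(ltW Z0)//.
  - by apply: prodr_ge0 => j _; exact: sqr_ge0.
  - have tz : theta w 0 / Z <= expR (16 * (K * eps) / A%:~R).
      apply: le_trans (expR_ge1Dx _); rewrite ler_pdivrMr//.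
      have h : theta w 0 - Z <= 16 * (K * eps * Z) / A%:~R.
        by rewrite ler_pdivlMr ?AR0// mulrC.
      rewrite [leRHS](_ : _ = Z + 16 * (K * eps * Z) / A%:~R); last by ring.
      by move: (_ / A%:~R) h => u h; lra.
    apply: le_trans (_ : expR (16 * (K * eps) / A%:~R) ^+ nnz c <= _).
      by rewrite lerXn2r ?nnegrE ?expR_ge0 ?divr_ge0 ?theta_ge0 ?(ltW Z0).
    rewrite -expRM_natl ler_expR mulrA ler_pdivrMr//.
    have nA : (nnz c)%:R <= A%:~R :> R.
      by have := nnz_le_sqnorm c; rewrite -(ler_int R) -pmulrn.
    rewrite mulrC -[16 * K * eps]mulrA; apply: ler_wpM2l nA.
    by rewrite !mulr_ge0// ltW.
  - apply: le_trans (prod_conv_error_le _ y1) _.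
    by rewrite ler_expR ler_pM2l.
have DE : D <= expR (16 * K + 32).
  by rewrite ler_expR ler_piMr ?(ltW e1)//; lra.
have D1 : D <= 1 + (16 * K + 32) * eps * expR (16 * K + 32).
  have := expR_ge1Dx (- ((16 * K + 32) * eps)); rewrite expRN -/D => h.
  have {h} : (1 - (16 * K + 32) * eps) * D <= 1.
    by have := ler_wpM2r (ltW D0) h; rewrite mulVf ?gt_eqF.
  have u0 : 0 <= (16 * K + 32) * eps by rewrite mulr_ge0 ?(ltW e0)//; lra.
  have := ler_wpM2l u0 DE; lra.
pose s := [seq k <- Zq q | P `|k|].
have pw t : (P `|cmod q t|)%:R <= (q%:R / 2 < (`|t|%:~R : R))%R%:R + ((t \in s)%:R + (t
  *+ 2 == q%:Z)%:R) :> R.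
  have [ht|ht] := ltP (q%:R / 2) (`|t|%:~R : R).
    rewrite -!natrD ler_nat; case: (P _) => //.
  have tq : `|t| *+ 2 <= q%:Z.
    by rewrite -(ler_int R) mulr2n intrD -pmulrn; lra.
  rewrite norm_cmod// mem_filter -!natrD ler_nat.
  have : (t \in Zq q) || (t *+ 2 == q%:Z).
    by rewrite in_Zq; move: tq; rewrite !mulr2n; clear; lia.
  by case: (P _) => //=; case: (t \in Zq q) => //=; case: (_ == _).
apply: le_trans (expect_dot_le val chi0 c pw) _.
rewrite !expect_dotD expect_dot_sum_law; last by rewrite filter_uniq// fset_uniq.
set PrY := Pr _ _.
(* Because [ZV <= H], normalising over [Zq] in place of all integers only enlarges the bound. *)
have main : \sum_(k <- s) law val chi c k <= D * PrY.
  rewrite /s big_filter /PrY (Pr_dnormal q V (fun k => P `|k|)) -/ZV.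
  apply: (@le_trans _ _ (\sum_(k <- Zq q | P `|k|) D * (gauss V k%:~R / ZV))).
    apply: ler_sum => k _; apply: le_trans (lawb k) _.
    by rewrite ler_pM2l// ler_wpM2l ?gauss_ge0// lef_pV2.
  by rewrite -mulr_sumr mulr_suml.
have at_half : expect_dot val chi c (fun t => (t *+ 2 == q%:Z)%:R) <=
    D * (eps + expR 4 * (K * eps)).
  have Keps0 : 0 <= expR 4 * (K * eps).
    by rewrite !mulr_ge0 ?expR_ge0 ?(ltW e0).
  pose k : int := (q %/ 2)%N.
  have [kq|kq] := eqVneq (k *+ 2) q%:Z.
    rewrite (_ : expect_dot _ _ _ _ = law val chi c k); last first.
      rewrite /law; congr expect_dot; apply/funext => t; congr (_%:R).
      by move: kq; rewrite !mulr2n; clear; lia.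
    apply: le_trans (lawb k) _; rewrite ler_pM2l// ler_pdivrMr//.
    apply: le_trans (atom k kq) _; rewrite [leRHS]mulrDl.
    apply: lerD; first by apply: le_trans ye _; rewrite ler_peMr// ltW.
    rewrite -[leRHS]mulrA ler_pM2l ?expR_gt0//; apply: ler_wpM2l HZ.
    by rewrite mulr_ge0// ltW.
  (* For odd [q] no integer equals [q / 2], and the event is empty. *)
  rewrite (_ : expect_dot _ _ _ _ = expect_dot val chi c (fun=> 0)).
    by rewrite expect_dot_cst// mulr_ge0 ?addr_ge0 ?(ltW D0) ?(ltW e0).
  congr expect_dot; apply/funext => t; rewrite (_ : (_ == _) = false)//.
  by move: kq; rewrite /k !mulr2n; clear; lia.
have Pr1 : PrY <= 1.
  rewrite -subr_ge0 -(Pr_dnormalC V (fun k => P `|k|) q0).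
  by apply: sumr_ge0 => y _; exact: dnormal_ge0.
have D1' : 1 <= D.
  by rewrite -expR0 ler_expR mulr_ge0 ?(ltW e0)//; lra.
have X0 : 0 <= eps + expR 4 * (K * eps).
  by rewrite addr_ge0 ?mulr_ge0 ?expR_ge0 ?(ltW e0).
have DX := ler_wpM2r X0 DE.
have DP : D * PrY <= PrY + (D - 1).
  have : 0 <= (D - 1) * (1 - PrY) by rewrite mulr_ge0 ?subr_ge0.
  lra.
rewrite /error_rate; move: D1 DX hover main at_half DP.
move: (expR 4) (expR (16 * K + 32)) (expect_dot _ _ _ _) (expect_dot _ _ _ _) => x E u1
  u2.
lra.
Qed.

End ResidualTest.

Theorem theorem1 (R : realType) (K : R) :
  exists C : R,
  forall (q v M N : nat) (sigma eps Omega alpha gamma : R) (r : int)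
    (Tc : 'M[int]_(M, N)) (P : 'M[int]_(M, v)) (s : 'cV[int]_v)
    (rho d : 'cV[int]_M),
  let c : 'cV[int]_N := Tc^T *m d in
  let chi : Zq q -> R := dnormal 0 (sigma ^+ 2) in
  let err (e : 'cV[Zq q]_N) : 'cV[int]_M := Tc *m map_mx val e in
  let X (e : 'cV[Zq q]_N) : int :=
    (lincomb q d (enc_residual q P s r rho (err e))).2 in
  (0 < q)%N -> 0 < sigma -> 0 < r -> 0 < eps < 1 ->
  (forall i j, P i j \in Zq q) -> (forall i, s i 0 \in Zq q) ->
  filtering_vector q P d ->
  gcd_vec c = 1 ->
  0 < Omega < 1 ->
  sigma ^+ 2 < q%:R ^+ 2 / 4 * (Omega ^+ 2 / l2norm R c ^+ 2) ->
  Pr chi [pred z | q%:R / 2 < l2norm R c * (`|val z|%:~R : R)] <= K * eps ->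
  Pr (iid_vec chi)
     [pred e | q%:R / 2 <
        `|(r * (d^T *m rho) 0 0 + (d^T *m err e) 0 0)%:~R : R|] <= K * eps ->
  0 < alpha < 1 ->
  Pr (dnormal 0 (quadform (res_cov sigma Tc) d) : Zq q -> R)
     [pred y | gamma <= (`|val y|%:~R : R)] = alpha ->
  l2norm R c ^+ 2 * smoothing (intlattice R) eps ^+ 2 <= sigma ^+ 2 ->
  rho = 0 ->
  `| Pr (iid_vec chi) [pred e | gamma <= (`|X e|%:~R : R)] - alpha | <= C * eps.
Proof.
exists (error_rate `|K| + expR 64).
move=> q v M N sigma eps Omega alpha gamma r Tc P s rho d c chi err X.
move=> q0 s0 r0 e01 _ _ [_ _ dP];
  move=> gcd1 /andP[Om0 Om1] hsig hfar hover /andP[a0 a1] hY hsm rho0.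
have /andP[e0 e1] := e01.
pose cf i := c i 0; pose w := sigma ^+ 2; pose A := sqnorm cf.
pose Q (k : int) := gamma <= k%:~R.
have w0 : 0 < w by rewrite exprn_gt0.
have chi0 m : 0 <= chi m by exact: dnormal_ge0.
have chi1 : \sum_m chi m = 1 by exact: sum_dnormal.
have K0 : 0 <= K.
  by rewrite -(pmulr_lge0 _ e0); apply: le_trans hfar; exact: sumr_ge0.
rewrite (ger0_norm K0).
have A1 : 1 <= A.
  rewrite -gtz0_ge1 lt_neqAle sqnorm_ge0 andbT eq_sym; apply/eqP => A0.
  have [_ g0] := nnz_eq0 (sqnorm_eq0 A0).
  by move: gcd1; rewrite /gcd_vec -/(gcdf cf) g0.
have A1R : 1 <= A%:~R :> R by rewrite (_ : 1 = 1%:~R)// ler_int.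
have A0R : 0 < A%:~R :> R by lra.
have ncE : l2norm R c = Num.sqrt A%:~R by exact: l2normE.
have nc2 : l2norm R c ^+ 2 = A%:~R by rewrite ncE sqr_sqrtr// ltW.
rewrite quadform_res_cov -/w -/c -/cf -/A in hY.
rewrite nc2 in hsig hsm; rewrite ncE in hfar.
have PrE (B : pred int) :
    Pr (iid_vec chi) [pred e | B `|X e|] = expect_dot val chi cf (fun t => (B `|cmod q
      t|)%:R).
  rewrite -(Pr_dot val chi cf (fun t => B `|cmod q t|)); apply: eq_bigl => e.
  by rewrite !inE /X rho0 filtered_residual.
have over : expect_dot val chi cf (fun t => (q%:R / 2 < (`|t|%:~R : R))%R%:R) <= K *
  eps.
  apply: le_trans hover;
    rewrite -(Pr_dot val chi cf (fun t => q%:R / 2 < (`|t|%:~R : R))).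
  rewrite le_eqVlt; apply/orP; left; apply/eqP; apply: eq_bigl => e.
  by rewrite !inE rho0 mulmx0 mxE mulr0 add0r /err dot_residual -intr_norm.
have PrX0 B : 0 <= expect_dot val chi cf (fun t => (B `|cmod q t|)%:R).
  by rewrite -(expect_dot_cst val chi1 cf 0); apply: expect_dot_le => // t;
    exact: ler0n.
have PrXC : expect_dot val chi cf (fun t => (~~ Q `|cmod q t|)%:R) =
    1 - expect_dot val chi cf (fun t => (Q `|cmod q t|)%:R).
  apply: (addIr (expect_dot val chi cf (fun t => (Q `|cmod q t|)%:R))).
  rewrite -expect_dotD subrK; transitivity (expect_dot val chi cf (fun=> 1)).
    by congr expect_dot; apply/funext => t; rewrite -natrD; case: (Q _).
  exact: expect_dot_cst.
have Er0 : 0 <= error_rate K by rewrite /error_rate !(addr_ge0, mulr_ge0, expR_ge0).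
rewrite (PrE Q).
have := PrX0 Q; have := PrX0 (fun k => ~~ Q k); rewrite PrXC.
(* For [eps >= expR (- 64)] the term [expR 64 * eps] is at least 1, and two numbers of [[0, 1]]
   differ by no more than that. *)
have [big|small] := leP (expR (- 64)) eps.
  have : 1 <= expR 64 * eps by rewrite -ler_pdivrMl ?expR_gt0// mulr1 -expRN.
  have := mulr_ge0 Er0 (ltW e0).
  move: (expect_dot _ _ _ _) => p h1 h2 h3 h4; rewrite ler_norml mulrDl; lra.
have e64 : 0 <= expR 64 * eps by rewrite mulr_ge0 ?expR_ge0// ltW.
(* If [|c| = 1], then [|X|] and [|Y|] have the same law and the error is 0. *)
have [A1E|A1N] := eqVneq A 1.
  rewrite A1E mulr1 in hY.
  have -> : expect_dot val chi cf (fun t => (Q `|cmod q t|)%:R) = alpha.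
    have cmodZ (m : Zq q) : `|cmod q (val m)| = `|val m| by rewrite cmod_Zq//;
      exact: valP.
    rewrite expect_dot_unit//.
      rewrite -hY /Pr [RHS]big_mkcond; apply: eq_bigr => m _; rewrite inE cmodZ.
      by rewrite -/(Q _); case: (Q _); rewrite ?mulr1 ?mulr0.
    move=> m; rewrite cmodZ norm_cmod; [by rewrite normrN|exact: q0|].
    have := valP m; rewrite normrN in_Zq !mulr2n.
    by move: (val m) => t; clear; lia.
  move=> _ _; rewrite subrr normr0 mulr_ge0 ?(ltW e0)//.
  by rewrite addr_ge0 ?expR_ge0.
have A2 : 2 <= A by move: A1 A1N; clear; lia.
(* The hypothesis gives [eta^2 <= w / A], and [pi <= 4] permits the exponent [4 w / A]. *)
have ye : expR (- (4 * (w / A%:~R))) <= eps.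
  apply: le_trans (smoothing_intlattice_ge e01); rewrite ler_expR lerN2.
  set eta := smoothing _ _ in hsm *.
  apply: (@le_trans _ _ (4 * eta ^+ 2)).
    by rewrite ler_wpM2r ?sqr_ge0// pi_le4.
  by rewrite ler_pM2l// ler_pdivlMr// mulrC.
have wA : 16 * A%:~R <= w.
  have := le_lt_trans ye small; rewrite ltr_expR ltrN2 => h.
  by rewrite -ler_pdivlMr//; lra.
have wq : w * (4 * A%:~R) < q%:R ^+ 2.
  apply: (@lt_le_trans _ _ (q%:R ^+ 2 / 4 * (Omega ^+ 2 / A%:~R) * (4 * A%:~R))).
    by rewrite ltr_pM2r// mulr_gt0.
  rewrite [leLHS](_ : _ = q%:R ^+ 2 * Omega ^+ 2); last by field; rewrite gt_eqF.
  by rewrite ler_piMr ?sqr_ge0// exprn_ile1// ltW.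
have U B := @upper_bound R q N cf w K eps B q0 e01 gcd1 A2 wA wq ye hfar over.
(* The bound for the complement of the rejection event is the missing lower bound for the event. *)
have U1 := U Q; have U2 := U (fun k => ~~ Q k).
rewrite hY in U1.
rewrite PrXC (Pr_dnormalC _ (fun k => Q `|k|) q0) hY in U2.
move: U1 U2; move: (expect_dot _ _ _ _) => p U1 U2 _ _.
by rewrite ler_norml mulrDl; lra.
Qed.
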